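(* Let $Z$ be a closed convex set, let $H$ be a field on $Z$ and $G$ a function on $Z$ such that, with constants $M>0$, $\delta>0$, $L>0$: (i) $\langle H(z_2)-H(z_1),z_2-z_1\rangle\ge 0$ for all $z_1,z_2\in Z$, and $$\langle H(z_1)-H(z_2),z_1-z_3\rangle\le \tfrac M2\|z_1-z_2\|^2+\tfrac M2\|z_1-z_3\|^2+\delta\qquad\forall z_1,z_2,z_3\in Z;$$ (ii) $G$ is differentiable, convex and $L$-smooth: $0\le G(z_2)-G(z_1)-\langle\nabla G(z_1),z_2-z_1\rangle\le\frac L2\|z_2-z_1\|^2$ for all $z_1,z_2\in Z$. Let $\mathcal H(z;\zeta)$ be a stochastic estimate of $H$. Run the stochastic mirror-prox sliding (SMPS) method (described in the context) with $N$ outer steps and suppose that the samples $\zeta_k^s$ are independent and that for all $1\le k\le N$, $1\le t\le T_k$, $$\mathbb E_{\zeta_k^{2t-1}}[\mathcal H(z_k^{t-1};\zeta_k^{2t-1})]=H(z_k^{t-1}),\qquad \mathbb E_{\zeta_k^{2t}}[\mathcal H(\tilde z_k^t;\zeta_k^{2t})]=H(\tilde z_k^t),$$ $$\mathbb E_{\zeta_k^{2t-1}}\|\mathcal H(z_k^{t-1};\zeta_k^{2t-1})-H(z_k^{t-1})\|^2\le\sigma^2,\qquad \mathbb E_{\zeta_k^{2t}}\|\mathcal H(\tilde z_k^t;\zeta_k^{2t})-H(\tilde z_k^t)\|^2\le\sigma^2 .$$ Let the parameters be $$\gamma_k=\frac2{k+1},\quad\beta_k=\frac{2L}k,\quad T_k=\left\lceil\frac{\sqrt3\,kM}{L}+\frac{Nk^2\sigma^2}{\Omega_{z_0}^2L^2}\right\rceil,\quad\eta_k^t=\beta_k(t-1)+\frac{LT_k}k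 .$$ Then, for $\varepsilon>0$, in order to compute an approximate solution $\overline z_N$ such that $\mathbb E\sup_{z\in Z}Q(\overline z_N,z)\le\varepsilon+\delta$, the numbers $N_{\nabla G}$ and $N_H$ of evaluations of the gradient $\nabla G(\cdot)$ and of the (stochastic) operator are bounded respectively by $$N_{\nabla G}=O\left(\sqrt{\frac{L\Omega_{z_0}^2}{\varepsilon}}\right),\qquad N_H=O\left(\frac{M\Omega_{z_0}^2}{\varepsilon}+\frac{\sigma^2\Omega_{z_0}^2}{\varepsilon^2}+\sqrt{\frac{L\Omega_{z_0}^2}{\varepsilon}}\right),$$ where $\Omega_{z_0}^2=\sup_{z\in Z}V(z_0,z)$.
   Context: $\|\cdot\|$ is the $\ell_2$-norm. $d$ is a (differentiable) prox-function that is $1$-strongly convex with respect to $\|\cdot\|$, and $V(x,y)=d(y)-d(x)-\langle\nabla d(x),y-x\rangle$ is the associated Bregman divergence (first argument is the prox-center). The problem considered is the variational inequality: find $z^*\in Z$ with $\langle H(z)+\nabla G(z),z^*-z\rangle\le 0$ for all $z\in Z$. The accuracy measure is $$Q(z_1,z_2)=G(z_1)-G(z_2)+\langle H(z_2),z_1-z_2\rangle .$$ SMPS method. Input: $z_0\in Z$, number $N$ of outer steps, inner step numbers $T_k$, parameters $\beta_k,\eta_k^t,\gamma_k$ ($1\le k\le N$, $1\le t\le T_k$). Set $\overline z_0=z_0$. For $k=1,\dots,N$: compute $\underline z_k=(1-\gamma_k)\overline z_{k-1}+\gamma_kz_{k-1}$ and set $z_k^0=z_{k-1}$; for $t=1,\dots,T_k$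 compute $$\tilde z_k^t=\operatorname*{argmin}_{z\in Z}\ \langle\nabla G(\underline z_k)+\mathcal H(z_k^{t-1};\zeta_k^{2t-1}),z\rangle+\beta_kV(z_{k-1},z)+\eta_k^tV(z_k^{t-1},z),$$ $$z_k^t=\operatorname*{argmin}_{z\in Z}\ \langle\nabla G(\underline z_k)+\mathcal H(\tilde z_k^t;\zeta_k^{2t}),z\rangle+\beta_kV(z_{k-1},z)+\eta_k^tV(z_k^{t-1},z);$$ then set $z_k=z_k^{T_k}$, $\tilde z_k=\frac1{T_k}\sum_{t=1}^{T_k}\tilde z_k^t$ and $\overline z_k=(1-\gamma_k)\overline z_{k-1}+\gamma_k\tilde z_k$. Output: $\overline z_N$. The gradient $\nabla G(\underline z_k)$ is evaluated once per outer step $k$. The expectations $\mathbb E_{\zeta_k^s}$ are over the fresh sample $\zeta_k^s$, with all previous samples fixed. $O(\cdot)$ hides absolute constants; as counts are positive integers, the bounds are understood in the regime where $L\Omega_{z_0}^2/\varepsilon\ge1$. *)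

(* Defs.v *)
From HB Require Import structures.
From mathcomp Require Import all_boot all_order all_algebra finmap.
From mathcomp Require Import all_classical all_reals all_analysis.

Set Implicit Arguments.
Unset Strict Implicit.
Unset Printing Implicit Defensive.

Import Order.TTheory GRing.Theory Num.Theory.
Import numFieldNormedType.Exports.

Local Open Scope classical_set_scope.
Local Open Scope ring_scope.

(* The library norm on ['rV[R]_n] is the max-norm; it induces the same
   topology as [l2norm], so [closed], [nbhs] and [open] below are the
   usual Euclidean ones. *)
Definition dotp (R : realType) (n : nat) (u v : 'rV[R]_n) : R :=
  \sum_(j < n) u 0 j * v 0 j.

Definition l2norm (R : realType) (n : nat) (u : 'rV[R]_n) : R :=
  Num.sqrt (dotp u u).

(* [d] and [G] only matter on [Z], which may have empty interior, so
   differentiability is taken relative to [Z]. A function differentiable near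
   [Z] satisfies this with its usual gradient. *)
Definition gradient_on (R : realType) (n : nat) (Z : set 'rV[R]_n)
    (f : 'rV[R]_n -> R) (gradf : 'rV[R]_n -> 'rV[R]_n) : Prop :=
  forall x, Z x -> forall e : R, 0 < e ->
    \forall y \near within Z (nbhs x),
      `|f y - f x - dotp (gradf x) (y - x)| <= e * l2norm (y - x).

Definition strongly_convex_on (R : realType) (n : nat) (mu : R)
    (Z : set 'rV[R]_n) (f : 'rV[R]_n -> R) : Prop :=
  forall x y (t : R), Z x -> Z y -> 0 <= t <= 1 ->
    f (t *: x + (1 - t) *: y) <=
      t * f x + (1 - t) * f y - mu / 2 * t * (1 - t) * l2norm (x - y) ^+ 2.

Definition prox_function (R : realType) (n : nat) (Z : set 'rV[R]_n)
    (d : 'rV[R]_n -> R) (gradd : 'rV[R]_n -> 'rV[R]_n) : Prop :=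
  gradient_on Z d gradd /\ strongly_convex_on 1 Z d.

Definition bregman (R : realType) (n : nat) (d : 'rV[R]_n -> R)
    (gradd : 'rV[R]_n -> 'rV[R]_n) (x y : 'rV[R]_n) : R :=
  d y - d x - dotp (gradd x) (y - x).

(* [Omega_{z0}^2]; meaningful when the set of values is bounded above. *)
Definition Omega2 (R : realType) (n : nat) (Z : set 'rV[R]_n)
    (d : 'rV[R]_n -> R) (gradd : 'rV[R]_n -> 'rV[R]_n) (z0 : 'rV[R]_n) : R :=
  sup [set bregman d gradd z0 z | z in Z].

Definition monotone_on (R : realType) (n : nat) (Z : set 'rV[R]_n)
    (H : 'rV[R]_n -> 'rV[R]_n) : Prop :=
  forall z1 z2, Z z1 -> Z z2 -> 0 <= dotp (H z2 - H z1) (z2 - z1).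

Definition delta_smooth_on (R : realType) (n : nat) (M delta : R)
    (Z : set 'rV[R]_n) (H : 'rV[R]_n -> 'rV[R]_n) : Prop :=
  forall z1 z2 z3, Z z1 -> Z z2 -> Z z3 ->
    dotp (H z1 - H z2) (z1 - z3) <=
      M / 2 * l2norm (z1 - z2) ^+ 2 + M / 2 * l2norm (z1 - z3) ^+ 2 + delta.

Definition convex_smooth_on (R : realType) (n : nat) (L : R)
    (Z : set 'rV[R]_n) (G : 'rV[R]_n -> R)
    (gradG : 'rV[R]_n -> 'rV[R]_n) : Prop :=
  gradient_on Z G gradG /\
  forall z1 z2, Z z1 -> Z z2 ->
    0 <= G z2 - G z1 - dotp (gradG z1) (z2 - z1)
      <= L / 2 * l2norm (z2 - z1) ^+ 2.

Definition Qgap (R : realType) (n : nat) (G : 'rV[R]_n -> R)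
    (H : 'rV[R]_n -> 'rV[R]_n) (z1 z2 : 'rV[R]_n) : R :=
  G z1 - G z2 + dotp (H z2) (z1 - z2).

Definition is_argmin (R : realType) (n : nat) (Z : set 'rV[R]_n)
    (f : 'rV[R]_n -> R) (z : 'rV[R]_n) : Prop :=
  Z z /\ forall y, Z y -> f z <= f y.

(* Iterates indexed as in the method: [k] from 1 ([z_outer] and [z_bar] from
   0), [t] from 1 ([z_in] from 0); [z_in it k t] is z_k^t, [z_tilde it k t] is
   \tilde z_k^t, [z_outer it k] is z_k. Other indices are irrelevant. *)
Record smps_iterates (R : realType) (n : nat) := SmpsIterates {
  z_low : nat -> 'rV[R]_n;
  z_bar : nat -> 'rV[R]_n;
  z_outer : nat -> 'rV[R]_n;
  z_in : nat -> nat -> 'rV[R]_n;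
  z_tilde : nat -> nat -> 'rV[R]_n }.

(* Objective of both prox steps: [g] is the gradient of G at the current
   z_low, [h] the operator estimate, [a] and [b] the two prox-centers. *)
Definition smps_obj (R : realType) (n : nat) (d : 'rV[R]_n -> R)
    (gradd : 'rV[R]_n -> 'rV[R]_n) (beta eta : R) (g h a b : 'rV[R]_n)
    (z : 'rV[R]_n) : R :=
  dotp (g + h) z + beta * bregman d gradd a z + eta * bregman d gradd b z.

(* [it] is the run of the method on the realized samples [zeta k s];
   its output is [z_bar it N]. *)
Definition smps_run (R : realType) (n : nat) (S : Type) (Z : set 'rV[R]_n)
    (d : 'rV[R]_n -> R) (gradd gradG : 'rV[R]_n -> 'rV[R]_n)
    (calH : 'rV[R]_n -> S -> 'rV[R]_n) (z0 : 'rV[R]_n) (N : nat)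
    (T : nat -> nat) (beta gamma : nat -> R) (eta : nat -> nat -> R)
    (zeta : nat -> nat -> S) (it : smps_iterates R n) : Prop :=
  [/\ z_outer it 0 = z0,
      z_bar it 0 = z0 &
      forall k, (1 <= k <= N)%N ->
      [/\ z_low it k =
            (1 - gamma k) *: z_bar it k.-1 + gamma k *: z_outer it k.-1,
          z_in it k 0 = z_outer it k.-1,
          (forall t, (1 <= t <= T k)%N ->
             is_argmin Z
               (smps_obj d gradd (beta k) (eta k t) (gradG (z_low it k))
                  (calH (z_in it k t.-1) (zeta k (2 * t).-1%N))
                  (z_outer it k.-1) (z_in it k t.-1))
               (z_tilde it k t) /\
             is_argmin Z
               (smps_obj d gradd (beta k) (eta k t) (gradG (z_low it k))
                  (calH (z_tilde it k t) (zeta k (2 * t)%N))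
                  (z_outer it k.-1) (z_in it k t.-1))
               (z_in it k t)),
          z_outer it k = z_in it k (T k) &
          z_bar it k = (1 - gamma k) *: z_bar it k.-1 +
            gamma k *: ((T k)%:R^-1 *: \sum_(1 <= t < (T k).+1) z_tilde it k t)
      ]].

Definition smps_gamma (R : realType) (k : nat) : R := 2 / k.+1%:R.

Definition smps_beta (R : realType) (L : R) (k : nat) : R := 2 * L / k%:R.

(* [absz] only casts to [nat]: the argument is nonnegative in the theorem. *)
Definition smps_T (R : realType) (L M sigma Om2 : R) (N k : nat) : nat :=
  `|Num.ceil (Num.sqrt 3 * k%:R * M / L
              + N%:R * k%:R ^+ 2 * sigma ^+ 2 / (Om2 * L ^+ 2))|%N.

Definition smps_eta (R : realType) (L : R) (T : nat -> nat) (k t : nat) : R :=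
  smps_beta L k * (t%:R - 1) + L * (T k)%:R / k%:R.

(* One gradient evaluation per outer step, two operator evaluations per inner
   step. *)
Definition smps_grad_evals (N : nat) : nat := (\sum_(1 <= k < N.+1) 1)%N.

Definition smps_oper_evals (N : nat) (T : nat -> nat) : nat :=
  (\sum_(1 <= k < N.+1) \sum_(1 <= t < (T k).+1) 2)%N.

Definition independent_on (R : realType) (dO dS : measure_display)
    (Omega : measurableType dO) (S : measurableType dS)
    (P : probability Omega R) (I : choiceType) (D : set I)
    (X : I -> Omega -> S) : Prop :=
  forall (J : {fset I}) (A : I -> set S),
    [set` J] `<=` D -> (forall i, i \in J -> measurable (A i)) ->
    P (\bigcap_(i in [set` J]) (X i @^-1` A i)) =
      (\prod_(i <- J) P (X i @^-1` A i))%E.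

Notation borel_rV R n := (g_sigma_algebraType (@open 'rV[R]_n)).

Definition jointly_measurable (R : realType) (n : nat) (dS : measure_display)
    (S : measurableType dS) (Z : set 'rV[R]_n)
    (calH : 'rV[R]_n -> S -> 'rV[R]_n) : Prop :=
  forall j : 'I_n,
    measurable_fun ((Z : set (borel_rV R n)) `*` [set: S])
      (fun p : borel_rV R n * S => calH p.1 p.2 0 j).

(* Coordinatewise mean equal to [H z], for a sample of law [mu] and a fixed
   point [z]. The equality of an integral with a real number includes
   integrability of the measurable integrand. *)
Definition unbiased_at (R : realType) (n : nat) (dS : measure_display)
    (S : measurableType dS) (mu : set S -> \bar R)
    (calH : 'rV[R]_n -> S -> 'rV[R]_n) (H : 'rV[R]_n -> 'rV[R]_n)
    (z : 'rV[R]_n) : Prop :=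
  forall j : 'I_n, (\int[mu]_s (calH z s 0 j)%:E = (H z 0 j)%:E)%E.

Definition variance_le_at (R : realType) (n : nat) (dS : measure_display)
    (S : measurableType dS) (mu : set S -> \bar R) (sigma : R)
    (calH : 'rV[R]_n -> S -> 'rV[R]_n) (H : 'rV[R]_n -> 'rV[R]_n)
    (z : 'rV[R]_n) : Prop :=
  (\int[mu]_s (l2norm (calH z s - H z) ^+ 2)%:E <= (sigma ^+ 2)%:E)%E.

Definition sample_indices (N : nat) (T : nat -> nat) : set (nat * nat) :=
  [set ks | (1 <= ks.1 <= N)%N /\ (1 <= ks.2 <= 2 * T ks.1)%N].

(* Expectations over the fresh sample, earlier samples being fixed, are
   integrals against the law of that sample at the realized iterate; they are
   required for almost every realization. *)
Definition stochastic_oracle (R : realType) (n : nat)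
    (dO dS : measure_display) (Omega : measurableType dO)
    (S : measurableType dS) (P : probability Omega R) (sigma : R)
    (calH : 'rV[R]_n -> S -> 'rV[R]_n) (H : 'rV[R]_n -> 'rV[R]_n)
    (N : nat) (T : nat -> nat) (zeta : nat -> nat -> {RV P >-> S})
    (it : Omega -> smps_iterates R n) : Prop :=
  forall k t, (1 <= k <= N)%N -> (1 <= t <= T k)%N ->
  {ae P, forall w,
    [/\ unbiased_at (distribution P (zeta k (2 * t).-1%N)) calH H
          (z_in (it w) k t.-1),
        unbiased_at (distribution P (zeta k (2 * t)%N)) calH H
          (z_tilde (it w) k t),
        variance_le_at (distribution P (zeta k (2 * t).-1%N)) sigma calH H
          (z_in (it w) k t.-1) &
        variance_le_at (distribution P (zeta k (2 * t)%N)) sigma calH H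
          (z_tilde (it w) k t)]}.

(* Main.v *)
Require Import Defs.
From HB Require Import structures.
From mathcomp Require Import all_boot all_order all_algebra finmap.
From mathcomp Require Import all_classical all_reals all_analysis.
From mathcomp Require Import measurable_realfun ring lra.

(** The method runs an accelerated gradient scheme on [G] (outer steps) whose
    prox subproblems are solved by extragradient (mirror-prox) steps on [H]
    (inner steps).

    Deterministic part. Fix the samples, and let the noise of an oracle call be
    its value minus [H]. Optimality of the two prox steps of an inner step
    ([prox_three_point]) and the smoothness of [H] give [inner_step_bound]:
    [dotp (grad G + H zt) (zt - z)] is at most a difference of Bregman
    divergences, plus [delta], plus [3 / eta] times the squared noises, minus
    the product of the second noise with [zt - z]. Since [eta_k^t] is affine in
    [t] with slope [beta_k], the divergences telescope over the inner loop. The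
    classical accelerated descent argument on [G] and the weights
    [k (k + 1) / 2] then make everything telescope over the outer loop
    ([run_bound]):
    [N (N + 1) / 2 * (Q - delta) <= 3 L V(z0, z) + weighted noise terms].

    Supremum over [z]. The point [z] enters the noise only through
    [dotp S (z - z0)], where [S] is the sum of the second noises with weights
    [k / T_k]. Young's inequality bounds it by
    [dotp S S / (2 L) + L Om2], which is uniform in [z].

    Probability. Each sample is independent of the earlier ones, and the
    iterates are functions of the earlier samples only; so noises are
    orthogonal to everything already known ([centred_orthogonal]). The term
    linear in the iterates therefore has mean zero and the second moment of [S]
    is at most the sum of the [(k / T_k)^2 sigma^2]. The choice of [T_k] makes
    all variance terms together at most [13/2 * L * Om2], whence a gap of at
    most [21 * L * Om2 / (N (N + 1)) + delta] ([expected_gap_le]). Taking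
    [N = ceil (5 sqrt (L Om2 / eps))] gives the theorem; the evaluation counts
    are then elementary.

    Three measure-theoretic points need care. The iterates are measurable with
    respect to the past: a minimizer of a strongly convex random objective is
    measurable because its coordinates are described by countably many
    comparisons of values of the objective ([mvec_argmin]), and the gradients
    only enter through directional derivatives, which are limits of difference
    quotients ([mvec_gradient]). The operator [H] itself need not be
    measurable; along the iterates it is replaced by the conditional mean of
    the oracle ([cond_mean]), to which it is almost surely equal. Finally the
    supremum of the gap need not be measurable, but its integral is still
    monotone ([ge0_integral_le_ae]). *)

Set Implicit Arguments.
Unset Strict Implicit.
Unset Printing Implicit Defensive.

Import Order.TTheory GRing.Theory Num.Theory.
Import numFieldNormedType.Exports.

Local Open Scope classical_set_scope.
Local Open Scope ring_scope.

(** * Euclidean geometry *)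

Section dotp_theory.
Context {R : realType} {n : nat}.
Implicit Types (u v w : 'rV[R]_n) (a c : R).

Lemma dotpC u v : dotp u v = dotp v u.
Proof. by apply: eq_bigr => j _; rewrite mulrC. Qed.

Lemma dotpDl u v w : dotp (u + v) w = dotp u w + dotp v w.
Proof. by rewrite /dotp -big_split; apply: eq_bigr => j _; rewrite mxE mulrDl. Qed.

Lemma dotpDr u v w : dotp u (v + w) = dotp u v + dotp u w.
Proof. by rewrite dotpC dotpDl !(dotpC _ u). Qed.

Lemma dotpZl a u v : dotp (a *: u) v = a * dotp u v.
Proof. by rewrite /dotp mulr_sumr; apply: eq_bigr => j _; rewrite mxE mulrA. Qed.

Lemma dotpZr a u v : dotp u (a *: v) = a * dotp u v.
Proof. by rewrite dotpC dotpZl dotpC. Qed.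

Lemma dotpNl u v : dotp (- u) v = - dotp u v.
Proof. by rewrite -scaleN1r dotpZl mulN1r. Qed.

Lemma dotpNr u v : dotp u (- v) = - dotp u v.
Proof. by rewrite dotpC dotpNl dotpC. Qed.

Lemma dotp0l u : dotp 0 u = 0.
Proof. by rewrite -(scale0r u) dotpZl mul0r. Qed.

Lemma dotp0r u : dotp u 0 = 0.
Proof. by rewrite dotpC dotp0l. Qed.

Lemma dotp_suml (I : Type) (s : seq I) (F : I -> 'rV[R]_n) v :
  dotp (\sum_(i <- s) F i) v = \sum_(i <- s) dotp (F i) v.
Proof.
elim: s => [|i s IH]; first by rewrite !big_nil dotp0l.
by rewrite !big_cons dotpDl IH.
Qed.

Lemma dotp_sumr (I : Type) (s : seq I) (F : I -> 'rV[R]_n) v :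
  dotp v (\sum_(i <- s) F i) = \sum_(i <- s) dotp v (F i).
Proof. by rewrite dotpC dotp_suml; apply: eq_bigr => i _; rewrite dotpC. Qed.

Lemma dotp_ge0 u : 0 <= dotp u u.
Proof. by apply: sumr_ge0 => j _; rewrite -expr2 sqr_ge0. Qed.

Lemma l2norm_sqr u : l2norm u ^+ 2 = dotp u u.
Proof. by rewrite sqr_sqrtr// dotp_ge0. Qed.

Lemma dotp_young c u v : 0 < c ->
  dotp u v <= dotp u u / (2 * c) + c / 2 * dotp v v.
Proof.
move=> c0; have := dotp_ge0 (u - c *: v).
rewrite !(dotpDl, dotpDr, dotpNl, dotpNr, dotpZl, dotpZr) (dotpC v u) => h.
rewrite -subr_ge0.
have -> : dotp u u / (2 * c) + c / 2 * dotp v v - dotp u v =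
  (dotp u u - c * dotp u v - (c * dotp u v - c * (c * dotp v v))) / (2 * c).
  by field; rewrite gt_eqF.
apply: divr_ge0; lra.
Qed.

Lemma dotpB_sqr_le u v :
  dotp (u - v) (u - v) <= 2 * dotp u u + 2 * dotp v v.
Proof.
have := dotp_ge0 (u + v).
rewrite !(dotpDl, dotpDr, dotpNl, dotpNr) (dotpC v u); lra.
Qed.

Lemma sqr_coord_le u j : u 0 j ^+ 2 <= dotp u u.
Proof.
rewrite /dotp (bigD1 j)//= expr2 lerDl.
by apply: sumr_ge0 => i _; rewrite -expr2 sqr_ge0.
Qed.

(** Jensen's inequality for the square; [c] recentres the average. *)
Lemma dotp_avg_le (m : nat) (F : nat -> 'rV[R]_n) (c : 'rV[R]_n)
    (u := m%:R^-1 *: \sum_(1 <= t < m.+1) F t) : (0 < m)%N ->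
  m%:R * dotp (u - c) (u - c) <= \sum_(1 <= t < m.+1) dotp (F t - c) (F t - c).
Proof.
move=> m0.
have mR : m%:R != 0 :> R by rewrite pnatr_eq0 -lt0n.
have uE : \sum_(1 <= t < m.+1) F t = m%:R *: u by rewrite scalerA divff// scale1r.
have cst a : \sum_(1 <= t < m.+1) a = m%:R * a :> R.
  by rewrite sumr_const_nat subn1 mulr_natl.
have h t : 2 * dotp (F t) (u - c) - dotp (u - c) (u - c)
    - 2 * dotp c (u - c) <= dotp (F t - c) (F t - c).
  have := dotp_ge0 (F t - u).
  rewrite !(dotpDl, dotpDr, dotpNl, dotpNr) (dotpC c u) (dotpC u (F t)) (dotpC c (F t)).
  lra.
apply: le_trans (ler_sum _ (fun t _ => h t)).
rewrite !sumrB !cst -mulr_sumr -dotp_suml uE.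
rewrite !(dotpZl, dotpDl, dotpDr, dotpNl, dotpNr) (dotpC c u); lra.
Qed.

End dotp_theory.

Section convex_segments.
Context {R : realType} {n : nat}.
Variable Z : set 'rV[R]_n.
Hypothesis cZ : convex_set Z.

Lemma convex_set_comb (x y : 'rV[R]_n) (s : R) : Z x -> Z y -> 0 <= s <= 1 ->
  Z ((1 - s) *: x + s *: y).
Proof.
move=> Zx Zy s01; have /andP[s0 s1] := s01.
have s01' : Itv.spec (@Itv.num_sem R) (Itv.Real `[0%Z, 1%Z]) s.
  by rewrite /Itv.spec /= /Itv.num_sem/= realE s0/= in_itv/= s0 s1.
have := @cZ y x (Itv.mk s01') (mem_set Zy) (mem_set Zx).
by move=> /set_mem; rewrite /conv/= addrC.
Qed.

Lemma convex_set_segment (x y : 'rV[R]_n) (s : R) : Z x -> Z y -> 0 <= s <= 1 ->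
  Z (x + s *: (y - x)).
Proof.
move=> Zx Zy s01; have := convex_set_comb Zx Zy s01.
by rewrite scalerBl scale1r scalerBr addrAC addrA.
Qed.

Lemma convex_set_avg (F : nat -> 'rV[R]_n) (m : nat) : (0 < m)%N ->
  (forall t, (1 <= t <= m)%N -> Z (F t)) ->
  Z (m%:R^-1 *: \sum_(1 <= t < m.+1) F t).
Proof.
elim: m => [//|[|m] IH] _ ZF.
  by rewrite big_nat1 invr1 scale1r; apply: ZF.
have Zm : Z (m.+1%:R^-1 *: \sum_(1 <= t < m.+2) F t).
  by apply: IH => // t /andP[t1 tm]; apply: ZF; rewrite t1 leqW.
have mR : m.+1%:R != 0 :> R by rewrite pnatr_eq0.
have mR2 : m.+2%:R != 0 :> R by rewrite pnatr_eq0.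
have s01 : 0 <= (m.+2%:R^-1 : R) <= 1.
  by rewrite invr_ge0 ler0n invf_le1 ?ltr0n// ler1n.
have := convex_set_comb Zm (ZF m.+2 (leqnn _)) s01.
rewrite [in X in _ -> Z X]big_nat_recr//= scalerDr scalerA.
suff -> : (1 - m.+2%:R^-1) * m.+1%:R^-1 = m.+2%:R^-1 :> R by [].
have h2 : m.+2%:R = m.+1%:R + 1 :> R by rewrite natr1.
by move: mR mR2; rewrite h2; move: (m.+1%:R : R) => x x0 x1; field; rewrite x0 x1.
Qed.

End convex_segments.

(** * Gradients relative to a convex set, Bregman divergences, prox steps *)

(** The entourages of row vectors are coordinatewise, so neighbourhoods are
    boxes; all metric arguments below go through this form. *)
Lemma nbhs_rV_box (R : realType) (n : nat) (x : 'rV[R]_n) (U : set 'rV[R]_n) :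
  nbhs x U <-> exists2 r : R, 0 < r &
    forall y : 'rV[R]_n, (forall j, `|y 0 j - x 0 j| < r) -> U y.
Proof.
split => [/nbhs_ballP[r /= r0 rU]|[r r0 rU]].
  exists r => // y yr; apply: rU; split => // i j.
  by rewrite (ord1 i) /ball/= distrC.
apply/nbhs_ballP; exists r => //= y [_ yr]; apply: rU => j.
by rewrite distrC; exact: yr.
Qed.

Section relative_gradient.
Context {R : realType} {n : nat}.
Variables (Z : set 'rV[R]_n) (f : 'rV[R]_n -> R) (gf : 'rV[R]_n -> 'rV[R]_n).
Hypotheses (cZ : convex_set Z) (fgf : gradient_on Z f gf).

Lemma gradient_on_box (x : 'rV[R]_n) (e : R) : Z x -> 0 < e ->
  exists2 r : R, 0 < r & forall y, Z y -> (forall j, `|y 0 j - x 0 j| < r) ->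
    `|f y - f x - dotp (gf x) (y - x)| <= e * l2norm (y - x).
Proof.
move=> Zx e0; have := fgf Zx e0; rewrite near_withinE => /nbhs_rV_box[r r0 h].
by exists r => // y Zy /h; apply.
Qed.

Lemma gradient_on_segment (x y : 'rV[R]_n) (e : R) : Z x -> Z y -> 0 < e ->
  exists2 s0 : R, 0 < s0 <= 1 & forall s, 0 < s <= s0 ->
    `|f (x + s *: (y - x)) - f x - s * dotp (gf x) (y - x)| <= e * s.
Proof.
move=> Zx Zy e0; set v := y - x.
have lv : 0 < 1 + l2norm v by rewrite ltr_pwDl// sqrtr_ge0.
have [r r0 h] := gradient_on_box Zx (divr_gt0 e0 lv).
pose K := 1 + \sum_j `|v 0 j|.
have K0 : 0 < K by rewrite ltr_pwDl// sumr_ge0.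
exists (Num.min 1 (r / K)).
  by rewrite lt_min ltr01 divr_gt0//= ge_min lexx.
move=> s; rewrite le_min => /andP[s0 /andP[s1 sr]].
have := h (x + s *: v) (convex_set_segment cZ Zx Zy _) _.
rewrite (addrC x) addrK dotpZr => /(_ _ _)/le_trans; apply.
- by rewrite ltW.
- move=> j; rewrite !mxE addrK normrM gtr0_norm//.
  have vK : `|v 0 j| < K.
    rewrite /K (bigD1 j)//= addrCA ltrDl ltr_pwDl//.
    by rewrite sumr_ge0.
  rewrite (_ : v 0 j = y 0 j - x 0 j) in vK; last by rewrite !mxE.
  apply: lt_le_trans (_ : s * K <= _); first by rewrite ltr_pM2l.
  by rewrite -ler_pdivlMr.
- have -> : l2norm (s *: v) = s * l2norm v.
    rewrite /l2norm dotpZl dotpZr mulrA -expr2 sqrtrM ?sqr_ge0//.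
    by rewrite sqrtr_sqr gtr0_norm.
  rewrite mulrAC -mulrA ler_pM2l// ler_pdivrMr//.
  by rewrite ler_pM2l// lerDr.
Qed.

Lemma gradient_on_continuous (x : 'rV[R]_n) (e : R) : Z x -> 0 < e ->
  exists2 r : R, 0 < r & forall y, Z y -> (forall j, `|y 0 j - x 0 j| < r) ->
    `|f y - f x| < e.
Proof.
move=> Zx e0; have [r r0 h] := gradient_on_box Zx ltr01.
pose K : R := 1 + \sum_j `|gf x 0 j| + n.+1%:R.
have S0 : 0 <= \sum_j `|gf x 0 j| by apply: sumr_ge0.
have K0 : 0 < K by rewrite addr_gt0 ?ltr0n// ltr_pwDl.
exists (Num.min r (e / K)); first by rewrite lt_min r0 divr_gt0.
move=> y Zy yr.
have yr1 j : `|(y - x) 0 j| < Num.min r (e / K) by rewrite !mxE.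
have hy : forall j, `|y 0 j - x 0 j| < r.
  by move=> j; move: (yr j); rewrite lt_min => /andP[].
have {h} := h y Zy hy; rewrite mul1r => h.
set s := Num.min r (e / K) in yr1.
have s0 : 0 < s by rewrite /s lt_min r0 divr_gt0.
have h1 : `|dotp (gf x) (y - x)| <= s * \sum_j `|gf x 0 j|.
  rewrite mulr_sumr; apply: le_trans (ler_norm_sum _ _ _) _.
  apply: ler_sum => j _; rewrite normrM mulrC ler_wpM2r//.
  exact/ltW/yr1.
have h2 : l2norm (y - x) <= s * n.+1%:R.
  rewrite -[leRHS]gtr0_norm ?mulr_gt0 ?ltr0n// -sqrtr_sqr ler_wsqrtr//.
  rewrite exprMn; apply: (@le_trans _ _ (\sum_(j < n) s ^+ 2)).
    apply: ler_sum => j _; rewrite -expr2 -real_normK ?num_real//.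
    by rewrite lerXn2r ?nnegrE ?normr_ge0 ?ltW// yr1.
  rewrite sumr_const card_ord -[leLHS]mulr_natr ler_pM2l ?exprn_gt0//.
  by rewrite -natrX ler_nat -[n in (n <= _)%N]expn1 (leq_trans (leqW _) (leq_pmull _ _))// expn1.
have sK : s * K <= e by rewrite -ler_pdivlMr// /s ge_min lexx orbT.
have : `|f y - f x| <= `|f y - f x - dotp (gf x) (y - x)| + `|dotp (gf x) (y - x)|.
  by apply: le_trans (ler_normD _ _); rewrite subrK.
move=> /le_lt_trans; apply; apply: le_lt_trans (lerD h h1) _.
apply: lt_le_trans sK; rewrite /K; nra.
Qed.

(** The only part of the gradient that matters on [Z] is its product with
    directions inside [Z], and these are limits of difference quotients. *)
Lemma gradient_on_limit (x y : 'rV[R]_n) : Z x -> Z y ->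
  (fun m => m.+1%:R * (f (x + m.+1%:R^-1 *: (y - x)) - f x)) @ \oo
    --> dotp (gf x) (y - x).
Proof.
move=> Zx Zy; apply/cvgrPdist_le => e e0.
have [s0 /andP[s00 _] h] := gradient_on_segment Zx Zy e0.
near=> m.
have m0 : 0 < m.+1%:R :> R by rewrite ltr0n.
have ms : m.+1%:R^-1 <= s0.
  rewrite invf_ple ?posrE ?ltr0n//; apply: ltW.
  near: m; exists (Num.bound (s0^-1)) => // k /= hk.
  apply: lt_le_trans (archi_boundP _) _; first by rewrite invr_ge0 ltW.
  by rewrite ler_nat ltnW.
have := h m.+1%:R^-1; rewrite invr_gt0 m0 ms => /(_ isT).
move=> h1; rewrite distrC; move: h1.
set a := f _ - f x; set b := dotp _ _ => h1.
have -> : m.+1%:R * a - b = m.+1%:R * (a - m.+1%:R^-1 * b).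
  by rewrite [in RHS]mulrBr mulrA divff ?mul1r// gt_eqF.
by rewrite normrM gtr0_norm// mulrC -ler_pdivlMr.
Unshelve. all: by end_near. Qed.

End relative_gradient.

(** First-order expansion at [x] of strong convexity along [x, y]. *)
Lemma bregman_ge (R : realType) (n : nat) (Z : set 'rV[R]_n)
    (d : 'rV[R]_n -> R) (gradd : 'rV[R]_n -> 'rV[R]_n) (x y : 'rV[R]_n) :
  convex_set Z -> prox_function Z d gradd -> Z x -> Z y ->
  dotp (y - x) (y - x) / 2 <= bregman d gradd x y.
Proof.
move=> cZ [dg dsc] Zx Zy; set q := dotp (y - x) _.
apply/ler_addgt0Pr => e e0.
have q0 : 0 <= q := dotp_ge0 _.
have e2 : 0 < e / 2 by rewrite divr_gt0.
have [s0 /andP[s00 s01] h] := gradient_on_segment cZ dg Zx Zy e2.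
pose s := Num.min s0 (e / (1 + q)).
have s_gt0 : 0 < s by rewrite lt_min s00 divr_gt0// ltr_pwDl.
have ss0 : s <= s0 by rewrite ge_min lexx.
have sq : s * q <= e.
  apply: (@le_trans _ _ (s * (1 + q))); first by nra.
  by rewrite -ler_pdivlMr ?ltr_pwDl// ge_min lexx orbT.
have := h s; rewrite s_gt0 ss0 => /(_ isT); rewrite ler_norml => /andP[h1 _].
have s1 : s <= 1 := le_trans ss0 s01.
have := dsc y x s Zy Zx; rewrite (ltW s_gt0) s1 l2norm_sqr => /(_ isT).
have -> : s *: y + (1 - s) *: x = x + s *: (y - x).
  by rewrite scalerBl scale1r scalerBr addrCA.
rewrite -/q /bregman => h2.
set D := dotp _ _ in h1 *.
rewrite -(ler_pM2l s_gt0).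
have : s * (s * q) <= s * e by rewrite ler_pM2l.
nra.
Qed.

(** Optimality of a prox step: the directional derivative of the objective at
    the minimizer is nonnegative, and the gradients of the two Bregman terms
    turn into differences of divergences. *)
Lemma prox_three_point (R : realType) (n : nat) (Z : set 'rV[R]_n)
    (d : 'rV[R]_n -> R) (gradd : 'rV[R]_n -> 'rV[R]_n) (beta eta : R)
    (g h a b z : 'rV[R]_n) :
  convex_set Z -> gradient_on Z d gradd ->
  is_argmin Z (smps_obj d gradd beta eta g h a b) z ->
  forall y, Z y ->
  dotp (g + h) (z - y) <=
    beta * (bregman d gradd a y - bregman d gradd a z - bregman d gradd z y) +
    eta * (bregman d gradd b y - bregman d gradd b z - bregman d gradd z y).
Proof.
move=> cZ dg [Zz zmin] y Zy.
rewrite /bregman !(dotpDl, dotpDr, dotpNl, dotpNr).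
pose D := dotp (g + h) (y - z) + (beta + eta) * dotp (gradd z) (y - z)
  - beta * dotp (gradd a) (y - z) - eta * dotp (gradd b) (y - z).
suff : 0 <= D by rewrite /D !(dotpDl, dotpDr, dotpNl, dotpNr); lra.
apply/ler_addgt0Pr => e e0.
pose K : R := 1 + `|beta + eta|.
have K0 : 0 < K by rewrite ltr_pwDl.
have [s0 /andP[s00 s01] hs] := gradient_on_segment cZ dg Zz Zy (divr_gt0 e0 K0).
have := hs s0; rewrite s00 lexx => /(_ isT); set r := _ - _ - _ => hr.
have Zs : Z (z + s0 *: (y - z)).
  by apply: (convex_set_segment cZ) => //; rewrite ltW.
have := zmin _ Zs.
have dE : d (z + s0 *: (y - z)) = r + d z + s0 * dotp (gradd z) (y - z).
  by rewrite /r; lra.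
rewrite /smps_obj /bregman dE !(dotpDl, dotpDr, dotpNl, dotpNr, dotpZr) => hm.
have hre : (beta + eta) * r <= s0 * e.
  apply: le_trans (ler_norm _) _; rewrite normrM.
  apply: le_trans (ler_wpM2l (normr_ge0 _) hr) _.
  rewrite mulrA [s0 * e]mulrC ler_pM2r// mulrCA ler_piMr ?(ltW e0)//.
  by rewrite ler_pdivrMr// mul1r lerDr.
rewrite -(ler_pM2l s00) mulr0 mulrDr.
apply: le_trans (_ : s0 * D + (beta + eta) * r <= _); last by rewrite lerD2l.
rewrite /D !(dotpDl, dotpDr, dotpNl, dotpNr); lra.
Qed.

(** * Deterministic analysis of one run *)

Section inner_step.
Context {R : realType} {n : nat}.
Variables (Z : set 'rV[R]_n) (d : 'rV[R]_n -> R) (gradd H : 'rV[R]_n -> 'rV[R]_n).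
Hypotheses (cZ : convex_set Z) (dprox : prox_function Z d gradd).
Notation V := (bregman d gradd).

(** Extragradient estimate for one inner step: the two three-point
    inequalities are added, the first one tested at the new point [zn]. The
    quadratic terms [V b zt] and [V zt zn] absorb the smoothness of [H] (two
    thirds of [eta]) and the noise (the remaining third, by Young). *)
Lemma inner_step_bound (M delta beta eta : R) (g h1 h2 a b zt zn z : 'rV[R]_n) :
  delta_smooth_on M delta Z H -> 0 <= beta -> 0 < eta -> 3 * M <= 2 * eta ->
  Z b -> Z z ->
  is_argmin Z (smps_obj d gradd beta eta g h1 a b) zt ->
  is_argmin Z (smps_obj d gradd beta eta g h2 a b) zn ->
  dotp (g + H zt) (zt - z) <=
    beta * (V a z - V zn z - V a zt) + eta * (V b z - V zn z) + delta
    + (3 / eta * (dotp (h1 - H b) (h1 - H b) + dotp (h2 - H zt) (h2 - H zt))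
       - dotp (h2 - H zt) (zt - z)).
Proof.
move=> Hsm beta0 eta0 Meta Zb Zz at_ an; have [Zt _] := at_; have [Zn _] := an.
have t1 := prox_three_point cZ dprox.1 at_ Zn.
have t2 := prox_three_point cZ dprox.1 an Zz.
have := Hsm zt b zn Zt Zb Zn; rewrite !l2norm_sqr => sm.
have v1 := bregman_ge cZ dprox Zb Zt.
have v2 := bregman_ge cZ dprox Zt Zn.
have c0 : 0 < eta / 3 by rewrite divr_gt0.
set D1 := h1 - H b; set D2 := h2 - H zt.
have yg := dotp_young (D2 - D1) (zt - zn) c0.
have sq := dotpB_sqr_le D2 D1.
have q1E : dotp (zt - b) (zt - b) = dotp (b - zt) (b - zt).
  by rewrite -[b - zt]opprB dotpNl dotpNr opprK.
have q2E : dotp (zn - zt) (zn - zt) = dotp (zt - zn) (zt - zn).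
  by rewrite -[zn - zt]opprB dotpNl dotpNr opprK.
rewrite q2E in v2; rewrite q1E in v1 *.
rewrite -/D1 -/D2 in sq yg *.
have q1 := dotp_ge0 (zt - b); have q2 := dotp_ge0 (zt - zn).
rewrite q1E in q1 sm.
move: q1 q2 v1 v2 sm yg sq.
set Q1 := dotp (b - zt) _; set Q2 := dotp (zt - zn) (zt - zn) => q1 q2 v1 v2 sm yg sq.
have noise : dotp (D2 - D1) (D2 - D1) / (2 * (eta / 3)) <=
    3 / eta * (dotp D1 D1 + dotp D2 D2).
  rewrite ler_pdivrMr ?mulr_gt0 ?divr_gt0//.
  have -> : 3 / eta * (dotp D1 D1 + dotp D2 D2) * (2 * (eta / 3)) =
    2 * (dotp D1 D1 + dotp D2 D2) by field; rewrite gt_eqF.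
  lra.
have e1 : eta * (Q1 / 2) <= eta * V b zt by rewrite ler_pM2l// -q1E.
have e2 : eta * (Q2 / 2) <= eta * V zt zn by rewrite ler_pM2l.
have b2 : beta * (Q2 / 2) <= beta * V zt zn by rewrite ler_wpM2l.
have b2' : 0 <= beta * (Q2 / 2) by rewrite mulr_ge0// divr_ge0.
have m1 : M / 2 * Q1 <= eta / 3 * Q1 by apply: ler_wpM2r => //; lra.
have m2 : M / 2 * Q2 <= eta / 3 * Q2 by apply: ler_wpM2r => //; lra.
have i1 : dotp (g + H zt) (zt - z) = dotp (g + h2) (zn - z) + dotp (g + h1) (zt - zn)
   + dotp (H zt - H b) (zt - zn) + dotp (D2 - D1) (zt - zn) - dotp D2 (zt - z).
  by rewrite /D1 /D2 !(dotpDl, dotpDr, dotpNl, dotpNr); ring.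
rewrite i1; have := mulr_ge0 (ltW eta0) q1; nra.
Qed.

End inner_step.

(** Abel summation for step sizes [eta_t] growing by [beta] at each step. *)
Lemma sum_linear_steps (R : realType) (beta c : R) (V : nat -> R) (m : nat) :
  \sum_(1 <= t < m.+1)
     (beta * (V 0 - V t) + (beta * (t%:R - 1) + c) * (V t.-1 - V t)) =
  (beta * m%:R + c) * (V 0 - V m).
Proof.
elim: m => [|m IH]; first by rewrite big_geq// subrr mulr0.
by rewrite big_nat_recr//= IH -[m.+1%:R]natr1; ring.
Qed.

Section run.
Context {R : realType} {n : nat} {S : Type}.
Variables (Z : set 'rV[R]_n) (d : 'rV[R]_n -> R) (gradd H : 'rV[R]_n -> 'rV[R]_n).
Variables (G : 'rV[R]_n -> R) (gradG : 'rV[R]_n -> 'rV[R]_n).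
Variables (z0 : 'rV[R]_n) (M delta L : R) (N : nat) (T : nat -> nat).
Variables (calH : 'rV[R]_n -> S -> 'rV[R]_n) (zeta : nat -> nat -> S).
Variable it : smps_iterates R n.
Hypotheses (cZ : convex_set Z) (Z0 : Z z0).
Hypothesis T_gt0 : forall k, (1 <= k <= N)%N -> (0 < T k)%N.
Hypothesis run : smps_run Z d gradd gradG calH z0 N T
  (smps_beta L) (smps_gamma R) (smps_eta L T) zeta it.

Let gamma01 k : (0 < k)%N -> 0 <= smps_gamma R k <= 1.
Proof.
move=> k0; rewrite /smps_gamma divr_ge0//= ler_pdivrMr ?ltr0n// mul1r.
by rewrite ler_nat ltnS.
Qed.

Lemma z_inner_in k t : (1 <= k <= N)%N -> (1 <= t <= T k)%N ->
  Z (z_in it k t) /\ Z (z_tilde it k t).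
Proof. by move=> kN tT; have [_ _ /(_ k kN)[_ _ /(_ t tT)[[? _] [? _]] _ _]] := run. Qed.

Lemma z_outer_bar_in k : (k <= N)%N -> Z (z_outer it k) /\ Z (z_bar it k).
Proof.
have [eo eb run_step] := run; elim: k => [|k IH] kN; first by rewrite eo eb.
have [_ _ _ -> ->] := run_step k.+1 kN; have [_ Zb] := IH (ltnW kN).
have T0 := @T_gt0 k.+1 kN.
split; first by have [] := @z_inner_in k.+1 (T k.+1) kN; rewrite ?leqnn ?T0.
apply: convex_set_comb => //; last exact: gamma01.
by apply: convex_set_avg => // t tT; have [] := @z_inner_in k.+1 t kN tT.
Qed.

Lemma z_low_in k : (1 <= k <= N)%N -> Z (z_low it k).
Proof.
case: k => [//|k] kN; have [_ _ /(_ k.+1 kN)[-> _ _ _ _]] := run.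
have [Zo Zb] := z_outer_bar_in (ltnW kN).
by apply: convex_set_comb => //; exact: gamma01.
Qed.

Lemma z_in_prev_in k t : (1 <= k <= N)%N -> (1 <= t <= T k)%N ->
  Z (z_in it k t.-1).
Proof.
move=> kN; case: t => [//|[|t]] tT; last first.
  by have [] := z_inner_in kN (ltnW tT : (1 <= t.+1 <= T k)%N).
case: k kN tT => [//|k] kN tT.
by have [_ _ /(_ k.+1 kN)[_ /= -> _ _ _]] := run; have [] := z_outer_bar_in (ltnW kN).
Qed.

Definition noise1 k t : 'rV[R]_n :=
  calH (z_in it k t.-1) (zeta k (2 * t).-1%N) - H (z_in it k t.-1).

Definition noise2 k t : 'rV[R]_n :=
  calH (z_tilde it k t) (zeta k (2 * t)%N) - H (z_tilde it k t).

(** Per-step error left by [inner_step_bound]; the factor [3 k / (L T_k)] is an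
    upper bound of [3 / eta_k^t], uniform in [t]. *)
Definition step_noise z k t : R :=
  3 * k%:R / (L * (T k)%:R) *
    (dotp (noise1 k t) (noise1 k t) + dotp (noise2 k t) (noise2 k t))
  - dotp (noise2 k t) (z_tilde it k t - z).

Hypotheses (dprox : prox_function Z d gradd) (L0 : 0 < L).
Hypothesis T_large : forall k, (1 <= k <= N)%N ->
  3 * M * k%:R <= 2 * L * (T k)%:R.
Hypotheses (Hmono : monotone_on Z H) (Hsm : delta_smooth_on M delta Z H).
Hypothesis Gsm : convex_smooth_on L Z G gradG.
Notation V := (bregman d gradd).

(** The inner loop: with [eta_t] linear in [t], the divergences telescope to
    [3 L T_k / k] times the progress of the outer sequence. *)
Lemma inner_loop_bound k z : (k < N)%N -> Z z ->
  \sum_(1 <= t < (T k.+1).+1)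
     dotp (gradG (z_low it k.+1) + H (z_tilde it k.+1 t)) (z_tilde it k.+1 t - z) <=
  3 * L * (T k.+1)%:R / k.+1%:R * (V (z_outer it k) z - V (z_outer it k.+1) z)
  - smps_beta L k.+1 * \sum_(1 <= t < (T k.+1).+1) V (z_outer it k) (z_tilde it k.+1 t)
  + (T k.+1)%:R * delta + \sum_(1 <= t < (T k.+1).+1) step_noise z k.+1 t.
Proof.
move=> kN Zz; have [_ _ /(_ k.+1 kN)[_ in0 steps out _]] := run.
have k0 : 0 < k.+1%:R :> R by rewrite ltr0n.
have T0 : 0 < (T k.+1)%:R :> R by rewrite ltr0n T_gt0.
set beta := smps_beta L k.+1; set c := L * (T k.+1)%:R / k.+1%:R.
have c0 : 0 < c by rewrite divr_gt0// mulr_gt0.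
have beta0 : 0 <= beta by rewrite divr_ge0// mulr_ge0// ltW.
have -> : 3 * L * (T k.+1)%:R / k.+1%:R * (V (z_outer it k) z - V (z_outer it k.+1) z)
    = (beta * (T k.+1)%:R + c) * (V (z_in it k.+1 0) z - V (z_in it k.+1 (T k.+1)) z).
  rewrite in0 out /beta /smps_beta /c /=; move: k0; move: (k.+1%:R : R) => x x0.
  by field; rewrite gt_eqF.
have -> : (T k.+1)%:R * delta = \sum_(1 <= t < (T k.+1).+1) delta.
  by rewrite sumr_const_nat subn1 mulr_natl.
rewrite -(sum_linear_steps beta c (fun t => V (z_in it k.+1 t) z)).
rewrite mulr_sumr -sumrB -!big_split/=; apply: ler_sum_nat => t; rewrite ltnS => tT.
have [at_ an] := steps t tT.
have etaE : smps_eta L T k.+1 t = beta * (t%:R - 1) + c by [].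
have t1 : 1 <= t%:R :> R by rewrite ler1n; case/andP: tT.
have eta_c : c <= smps_eta L T k.+1 t.
  by rewrite etaE lerDr mulr_ge0// subr_ge0.
have eta0 := lt_le_trans c0 eta_c.
have Meta : 3 * M <= 2 * smps_eta L T k.+1 t.
  apply: (@le_trans _ _ (2 * c)); last by rewrite ler_pM2l.
  by rewrite /c !mulrA ler_pdivlMr//; exact: T_large.
have := inner_step_bound cZ dprox Hsm beta0 eta0 Meta (z_in_prev_in (kN : (1 <= k.+1 <= N)%N) tT) Zz at_ an.
move=> /le_trans; apply.
rewrite -/beta -/(noise1 k.+1 t) -/(noise2 k.+1 t) etaE in0 /step_noise.
have : 3 / smps_eta L T k.+1 t <= 3 * k.+1%:R / (L * (T k.+1)%:R).
  rewrite -mulrA ler_pM2l// -invf_div -/c.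
  by rewrite lef_pV2// posrE.
have := addr_ge0 (dotp_ge0 (noise1 k.+1 t)) (dotp_ge0 (noise2 k.+1 t)).
rewrite etaE; move: (_ + _) => x; move: (3 / _) => y; move: (_ / (L * _)) => w x0 yw.
have := ler_wpM2r x0 yw; lra.
Qed.

(** The outer step, scaled by [k (k + 1) / 2] so that the contraction factor
    [1 - gamma_k] telescopes. *)
Lemma outer_step_bound k z : (k < N)%N -> Z z ->
  k.+1%:R * k.+2%:R / 2 * Qgap G H (z_bar it k.+1) z <=
  k%:R * k.+1%:R / 2 * Qgap G H (z_bar it k) z
  + 3 * L * (V (z_outer it k) z - V (z_outer it k.+1) z) + k.+1%:R * delta
  + k.+1%:R / (T k.+1)%:R * \sum_(1 <= t < (T k.+1).+1) step_noise z k.+1 t.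
Proof.
move=> kN Zz; have := inner_loop_bound kN Zz.
have [_ _ /(_ k.+1 kN)[lowE _ _ _ barE]] := run; rewrite /= in lowE barE.
have [Zo Zb] := z_outer_bar_in (ltnW kN); have [_ Zb'] := z_outer_bar_in kN.
have Zl : Z (z_low it k.+1) := @z_low_in k.+1 kN.
set beta := smps_beta L k.+1; set gam := smps_gamma R k.+1 in lowE barE.
set g := gradG _; set X := \sum_(_ <= _ < _) _; set W := \sum_(_ <= _ < _) V _ _.
set E := \sum_(_ <= _ < _) step_noise _ _ _ => hX.
set zt := _ *: \sum_(1 <= t < _) _ in barE.
have T0 : 0 < (T k.+1)%:R :> R by rewrite ltr0n T_gt0.
set m := T k.+1 in zt X W E T0 hX barE *.
have Zzt t : (1 <= t <= m)%N -> Z (z_tilde it k.+1 t).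
  by move=> tT; have [] := @z_inner_in k.+1 t kN tT.
have Zt : Z zt by apply: convex_set_avg => //; exact: T_gt0.
have sumE : \sum_(1 <= t < m.+1) z_tilde it k.+1 t = m%:R *: zt.
  by rewrite scalerA divff ?scale1r// gt_eqF.
have cst a : \sum_(1 <= t < m.+1) a = m%:R * a :> R.
  by rewrite sumr_const_nat subn1 mulr_natl.
have hlin : m%:R * dotp (g + H z) (zt - z) <= X.
  rewrite -dotpZr scalerBr -sumE.
  have -> : dotp (g + H z) (\sum_(1 <= t < m.+1) z_tilde it k.+1 t - m%:R *: z) =
    \sum_(1 <= t < m.+1) dotp (g + H z) (z_tilde it k.+1 t - z).
    rewrite dotpDr dotpNr dotp_sumr dotpZr -cst -sumrB; apply: eq_bigr => t _.
    by rewrite dotpDr dotpNr.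
  apply: ler_sum_nat => t; rewrite ltnS => tT.
  have := Hmono Zz (Zzt t tT).
  by rewrite !(dotpDl, dotpNl); lra.
have hW : m%:R * dotp (zt - z_outer it k) (zt - z_outer it k) <= 2 * W.
  apply: le_trans (dotp_avg_le _ _ (T_gt0 (kN : (1 <= k.+1 <= N)%N))) _.
  rewrite mulr_sumr; apply: ler_sum_nat => t; rewrite ltnS => tT.
  by have := bregman_ge cZ dprox Zo (Zzt t tT); lra.
have [_ Gs] := Gsm.
have /andP[_] := Gs _ _ Zl Zb'; have /andP[+ _] := Gs _ _ Zl Zb.
have /andP[+ _] := Gs _ _ Zl Zz.
rewrite -/g l2norm_sqr => G1 G2 G3.
have bl : z_bar it k.+1 - z_low it k.+1 = gam *: (zt - z_outer it k).
  by rewrite barE lowE scalerBr opprD addrACA subrr add0r.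
have dl : dotp g (z_bar it k.+1 - z_low it k.+1) =
    (1 - gam) * dotp g (z_bar it k - z_low it k.+1)
    + gam * dotp g (z - z_low it k.+1) + gam * dotp g (zt - z).
  by rewrite barE !(dotpDr, dotpNr, dotpZr); ring.
have hl : dotp (H z) (z_bar it k.+1 - z) =
    (1 - gam) * dotp (H z) (z_bar it k - z) + gam * dotp (H z) (zt - z).
  by rewrite barE !(dotpDr, dotpNr, dotpZr); ring.
rewrite dl bl dotpZl dotpZr in G3.
have /andP[gam0 gam1] := gamma01 (ltn0Sn k); rewrite -/gam in gam0 gam1.
have G1' := mulr_ge0 gam0 G1.
have gam1' : 0 <= 1 - gam by rewrite subr_ge0.
have G2' := mulr_ge0 gam1' G2.
rewrite /Qgap hl.
set q := dotp (zt - _) (zt - z_outer it k) in G3 hW.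
set Qk := G (z_bar it k) - G z + dotp (H z) (z_bar it k - z).
have key : m%:R * (G (z_bar it k.+1) - G z + ((1 - gam) * dotp (H z) (z_bar it k - z)
     + gam * dotp (H z) (zt - z))) <=
   m%:R * ((1 - gam) * Qk) + gam * X + L * gam ^+ 2 * W.
  apply: (@le_trans _ _ (m%:R * ((1 - gam) * Qk) + gam * (m%:R * dotp (g + H z) (zt - z))
     + L / 2 * gam ^+ 2 * (m%:R * q))); last first.
    have := ler_wpM2l gam0 hlin.
    have c0 : 0 <= L / 2 * gam ^+ 2 by rewrite mulr_ge0 ?sqr_ge0// divr_ge0// ltW.
    have := ler_wpM2l c0 hW; lra.
  rewrite (_ : _ + _ + _ = m%:R * ((1 - gam) * Qk + gam * dotp (g + H z) (zt - z)
     + L / 2 * gam ^+ 2 * q)); last by ring.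
  rewrite ler_pM2l// /Qk dotpDl; lra.
have W0 : 0 <= W.
  rewrite /W big_nat_cond; apply: sumr_ge0 => t; rewrite andbT ltnS => tT.
  apply: le_trans (bregman_ge cZ dprox Zo (Zzt t tT)).
  by rewrite divr_ge0// dotp_ge0.
have gamE : gam = 2 / k.+2%:R by [].
have betaE : beta = 2 * L / k.+1%:R by [].
have bg : L * gam <= beta.
  rewrite gamE betaE mulrCA mulrA ler_pM2l ?mulr_gt0// lef_pV2 ?posrE ?ltr0n//.
  by rewrite ler_nat.
have k2E : k.+2%:R = k.+1%:R + 1 :> R by rewrite natr1.
have k1E : k.+1%:R = k%:R + 1 :> R by rewrite natr1.
have key2 : m%:R * (G (z_bar it k.+1) - G z + ((1 - gam) * dotp (H z) (z_bar it k - z)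
     + gam * dotp (H z) (zt - z))) <=
   m%:R * ((1 - gam) * Qk) + gam * (3 * L * m%:R / k.+1%:R *
     (V (z_outer it k) z - V (z_outer it k.+1) z) + m%:R * delta + E).
  apply: le_trans key _.
  have := ler_wpM2l gam0 hX.
  have := ler_wpM2r W0 (ler_wpM2l gam0 bg).
  move: (3 * L * _ / _ * _) => B; rewrite expr2; lra.
have x0 : 0 < k.+1%:R :> R by rewrite ltr0n.
have y0 : 0 < k.+2%:R :> R by rewrite ltr0n.
have s0 : 0 < k.+1%:R * k.+2%:R / 2 / m%:R :> R by rewrite !(divr_gt0, mulr_gt0).
have := ler_wpM2l (ltW s0) key2.
set A := (X in _ * (m%:R * X) <= _); set B := V _ _ - V _ _.
have -> : k.+1%:R * k.+2%:R / 2 / m%:R * (m%:R * A) = k.+1%:R * k.+2%:R / 2 * A.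
  by field; rewrite gt_eqF.
move=> /le_trans; apply; rewrite le_eqVlt; apply/orP; left; apply/eqP.
have km : k%:R = k.+1%:R - 1 :> R by rewrite k1E addrK.
rewrite gamE km k2E; rewrite k2E in y0; move: x0 y0; move: (k.+1%:R : R) => x x0 y0.
by field; rewrite !gt_eqF.
Qed.

Lemma run_bound z : Z z ->
  N%:R * N.+1%:R / 2 * (Qgap G H (z_bar it N) z - delta) <=
  3 * L * V z0 z +
  \sum_(1 <= k < N.+1) (k%:R / (T k)%:R * \sum_(1 <= t < (T k).+1) step_noise z k t).
Proof.
move=> Zz.
suff /(_ N (leqnn N)) h : forall m, (m <= N)%N ->
    m%:R * m.+1%:R / 2 * (Qgap G H (z_bar it m) z - delta) <=
    3 * L * (V z0 z - V (z_outer it m) z) +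
    \sum_(1 <= k < m.+1) (k%:R / (T k)%:R * \sum_(1 <= t < (T k).+1) step_noise z k t).
  apply: (le_trans h); rewrite lerD2r ler_pM2l ?mulr_gt0// lerBlDr lerDl.
  have [Zo _] := z_outer_bar_in (leqnn N).
  apply: le_trans (bregman_ge cZ dprox Zo Zz).
  by rewrite divr_ge0// dotp_ge0.
elim=> [|m IH] mN.
  by have [-> _ _] := run; rewrite !mul0r subrr mulr0 big_geq// addr0.
rewrite big_nat_recr//=.
have := outer_step_bound mN Zz; have := IH (ltnW mN).
have -> : m.+2%:R = m%:R + 2 :> R by rewrite -addn2 natrD.
have -> : m.+1%:R = m%:R + 1 :> R by rewrite natr1.
move: (_ * \sum_(1 <= t < (T m.+1).+1) _) => e; move: (\sum_(1 <= k < m.+1) _) => f.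
lra.
Qed.

End run.

(** * Past sigma-algebras and freezing *)

Section past.
Context {R : realType} {dO dS : measure_display} {Omega : measurableType dO}
  {Xi : measurableType dS} {P : probability Omega R} {I : choiceType}.
Variable X : I -> {mfun Omega >-> Xi}.
Implicit Types B : set I.

(** A pi-system generating the sigma-algebra of the samples indexed by [B]:
    independence says exactly that [P] is multiplicative on it. *)
Definition past_cylinders B : set (set Omega) :=
  [set C | exists (J : {fset I}) (A : I -> set Xi),
    [/\ [set` J] `<=` B, forall i, i \in J -> measurable (A i) &
        C = \bigcap_(i in [set` J]) (X i @^-1` A i)]].

(** [Omega] with the events that depend only on the samples indexed by [B]. *)
Notation past_type B := (g_sigma_algebraType (past_cylinders B)).

Lemma past_cylindersT B : past_cylinders B setT.
Proof.
exists fset0, (fun=> setT); split => //.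
by apply/esym; rewrite -subTset => w _ i /=; rewrite inE.
Qed.

Lemma past_cylinders_setI B : setI_closed (past_cylinders B).
Proof.
move=> _ _ [J1 [A1 [JB1 mA1 ->]]] [J2 [A2 [JB2 mA2 ->]]].
exists (J1 `|` J2)%fset, (fun i => (if i \in J1 then A1 i else setT) `&`
  (if i \in J2 then A2 i else setT)); split.
- by move=> i /=; rewrite inE => /orP[]; [exact: JB1|exact: JB2].
- by move=> i _; apply: measurableI; case: ifPn => // iJ; [exact: mA1|exact: mA2].
- apply/seteqP; split=> w /=.
    move=> [h1 h2] i /=; rewrite inE => _; split.
      by case: ifPn => // iJ; exact: h1.
    by case: ifPn => // iJ; exact: h2.
  move=> h; split=> i /= iJ.
    by have := h i; rewrite /= inE iJ => /(_ isT)[].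
  by have := h i; rewrite /= inE iJ orbT => /(_ isT)[].
Qed.

Lemma past_cylinders_measurable B : past_cylinders B `<=` measurable.
Proof.
move=> _ [J [A [_ mA ->]]]; apply: fin_bigcap_measurable; first exact: finite_fset.
by move=> i /= iJ; rewrite -[X in measurable X]setTI; apply: measurable_funP => //; exact: mA.
Qed.

Lemma past_measurable B (A : set Omega) :
  measurable (A : set (past_type B)) -> measurable A.
Proof.
by apply: smallest_sub; [exact: sigma_algebra_measurable|exact: past_cylinders_measurable].
Qed.

Lemma past_type_le B B' (A : set Omega) : B `<=` B' ->
  measurable (A : set (past_type B)) -> measurable (A : set (past_type B')).
Proof.
move=> BB'; apply: sub_sigma_algebra2 => C [J [A' [JB mA' ->]]].
by exists J, A'; split => //; exact: subset_trans JB BB'.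
Qed.

Lemma past_sample_measurable B i : B i ->
  measurable_fun setT (X i : past_type B -> Xi).
Proof.
move=> Bi _ A mA; rewrite setTI; apply: sub_sigma_algebra.
exists [fset i]%fset, (fun=> A); split => //.
- by move=> j /=; rewrite inE => /eqP ->.
- apply/seteqP; split=> w /=; first by move=> Aw j /=; rewrite inE => /eqP ->.
  by apply; rewrite /= inE.
Qed.

Lemma past_measurable_fun_le d (T : measurableType d) B B' (f : Omega -> T) :
  B `<=` B' -> measurable_fun setT (f : past_type B -> T) ->
  measurable_fun setT (f : past_type B' -> T).
Proof.
by move=> BB' mf _ A mA; exact: (past_type_le BB' (mf measurableT A mA)).
Qed.

Lemma past_measurable_fun d (T : measurableType d) B (f : Omega -> T) :
  measurable_fun setT (f : past_type B -> T) -> measurable_fun setT f.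
Proof. by move=> mf _ A mA; exact: past_measurable (mf measurableT A mA). Qed.

Lemma past_id_measurable B : measurable_fun setT (id : Omega -> past_type B).
Proof. by move=> _ A mA; rewrite setTI; exact: (past_measurable mA). Qed.

Definition past_id B : {mfun Omega >-> past_type B} :=
  HB.pack (id : Omega -> past_type B)
    (isMeasurableFun.Build _ _ _ _ _ (@past_id_measurable B)).

Variable D : set I.
Hypothesis indep : independent_on P D (fun i => X i : Omega -> Xi).
Variables (B : set I) (i : I).
Hypotheses (BD : B `<=` D) (Di : D i) (Bi : ~ B i).
Notation mu := (distribution P (X i)).

Lemma past_independent_cylinder (A : set Omega) (C : set Xi) :
  past_cylinders B A -> measurable C ->
  P (A `&` X i @^-1` C) = (P A * P (X i @^-1` C))%E.
Proof.
move=> [J [A' [JB mA' ->]]] mC.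
have iJ : i \notin J by apply/negP => /JB.
pose A2 j := if j == i then C else A' j.
have JA2 j : j \in J -> A2 j = A' j.
  by rewrite /A2; case: eqP => // -> iJ'; rewrite iJ' in iJ.
have := indep (J := (i |` J)%fset) (A := A2).
rewrite (_ : \bigcap_(j in [set` (i |` J)%fset]) _ =
  \bigcap_(j in [set` J]) (X j @^-1` A' j) `&` X i @^-1` C); last first.
  apply/seteqP; split=> w /=.
    move=> h; split.
      move=> j /= jJ; have := h j; rewrite /= !inE jJ orbT JA2//; exact.
    by have := h i; rewrite /= !inE eqxx /A2 eqxx; exact.
  move=> [h hi] j /=; rewrite !inE => /orP[/eqP->|jJ]; first by rewrite /A2 eqxx.
  by rewrite JA2//; exact: h.
move=> -> //; last 2 first.
- by move=> j /=; rewrite !inE => /orP[/eqP->//|/JB/BD].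
- by move=> j; rewrite !inE => /orP[/eqP->|jJ]; [rewrite /A2 eqxx|rewrite JA2//; exact: mA'].
rewrite big_fsetU1//= {1}/A2 eqxx muleC; congr (_ * _)%E.
rewrite (indep (J := J))//; last by move=> j /JB/BD.
by rewrite !big_seq; apply: eq_bigr => j jJ; rewrite JA2.
Qed.

Lemma past_independent (A : set Omega) (C : set Xi) :
  measurable (A : set (past_type B)) -> measurable C ->
  P (A `&` X i @^-1` C) = (P A * P (X i @^-1` C))%E.
Proof.
move=> mA mC.
have mXC : measurable (X i @^-1` C).
  by rewrite -[Y in measurable Y]setTI; exact: measurable_funP.
pose r : {nonneg R} := NngNum (fine_ge0 (measure_ge0 P (X i @^-1` C))).
have rE : r%:num%:E = P (X i @^-1` C).
  by rewrite fineK// fin_num_measure.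
pose m1 := mrestr P mXC; pose m2 := mscale r P.
have -> : (P A * P (X i @^-1` C))%E = m2 A by rewrite muleC -rE.
apply: (@g_sigma_algebra_measure_unique _ _ _ (past_cylinders B) _ (fun=> setT)
  _ _ m1 m2 _ _ _ A mA).
- exact: past_cylinders_measurable.
- by move=> _; exact: past_cylindersT.
- by rewrite bigcup_const.
- exact: past_cylinders_setI.
- move=> A' cA'; rewrite /m1 /m2 /= /mscale /= rE muleC.
  exact: past_independent_cylinder.
- move=> _; rewrite /m1 /= /mrestr.
  by apply: le_lt_trans (probability_le1 _ _) _; rewrite ?ltry//; apply: measurableI.
Qed.

Let phi w : past_type B * Xi := (past_id B w, X i w).

Let mphi : measurable_fun setT phi.
Proof. by apply: measurable_fun_pair => //; exact: measurable_funP. Qed.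

(** The fresh sample is independent of the past, so the joint law is a product. *)
Lemma joint_law_product (A : set (past_type B * Xi)) : measurable A ->
  (distribution P (past_id B) \x mu)%E A = pushforward P phi A.
Proof.
apply: product_measure_unique => A1 A2 mA1 mA2.
exact: past_independent.
Qed.

Lemma freezing_ge0 (f : past_type B * Xi -> \bar R) :
  measurable_fun setT f -> (forall z, 0 <= f z)%E ->
  (\int[P]_w f (w, X i w) = \int[P]_w \int[mu]_s f (w, s))%E.
Proof.
move=> mf f0.
transitivity (\int[pushforward P phi]_z f z)%E.
  by rewrite ge0_integral_pushforward.
transitivity (\int[distribution P (past_id B) \x mu]_z f z)%E.
  by apply: eq_measure_integral => A mA _; exact/esym/joint_law_product.
rewrite fubini_tonelli1// ge0_integral_distribution//.
  exact: measurable_fun_fubini_tonelli_F.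
by move=> w; apply: integral_ge0.
Qed.

Lemma freezing (f : past_type B * Xi -> \bar R) :
  measurable_fun setT f -> P.-integrable setT (fun w => f (w, X i w)) ->
  (\int[P]_w f (w, X i w) = \int[P]_w \int[mu]_s f (w, s))%E.
Proof.
move=> mf intf.
have int2 : (distribution P (past_id B) \x mu)%E.-integrable setT f.
  apply/integrableP; split => //.
  have maf : measurable_fun setT (abse \o f) by exact: measurableT_comp.
  have af0 z : (0 <= (abse \o f) z)%E by exact: abse_ge0.
  rewrite (fubini_tonelli1 (abse \o f))// ge0_integral_distribution//.
  - by rewrite -[ltLHS](freezing_ge0 maf af0); case/integrableP : intf.
  - exact: measurable_fun_fubini_tonelli_F.
  - by move=> w; apply: integral_ge0.
transitivity (\int[pushforward P phi]_z f z)%E.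
  by rewrite integral_pushforward.
transitivity (\int[distribution P (past_id B) \x mu]_z f z)%E.
  by apply: eq_measure_integral => A mA _; exact/esym/joint_law_product.
rewrite -integral12_prod_meas1// integral_pushforward//.
  exact: measurable_fubini_F int2.
have := integrable_fubini_F int2.
move=> /integrableP[mF intF]; apply/integrableP; split.
  by apply: measurableT_comp => //; exact: measurable_funP.
by rewrite ge0_integral_distribution// in intF; exact: measurableT_comp.
Qed.

End past.

Notation past_type X B := (g_sigma_algebraType (past_cylinders X B)).

(** * Measurability of minimizers *)

Section rational_boxes.
Context {R : realType} {n : nat}.
Implicit Types (x y : 'rV[R]_n) (A : set 'rV[R]_n).

Definition in_box (q : 'rV[rat]_n * nat) x :=
  forall j, `|x 0 j - ratr (q.1 0 j)| < q.2.+1%:R^-1.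

Lemma in_box_small x (r : R) : 0 < r ->
  exists2 q : 'rV[rat]_n * nat, in_box q x &
    forall y, in_box q y -> forall j, `|y 0 j - x 0 j| < r.
Proof.
move=> r0; pose m := Num.bound (2 / r).
have m0 : 0 < m.+1%:R^-1 :> R by rewrite invr_gt0 ltr0n.
have mr : m.+1%:R^-1 + m.+1%:R^-1 < r.
  rewrite -mulr2n -[X in X < _]mulr_natl ltr_pdivrMr ?ltr0n// mulrC -ltr_pdivrMr//.
  apply: lt_trans (archi_boundP _) _; first by rewrite divr_ge0// ltW.
  by rewrite ltr_nat.
have hq j : exists q : rat, `|x 0 j - ratr q| < m.+1%:R^-1.
  have [|q] := @rat_in_itvoo R (x 0 j - m.+1%:R^-1) (x 0 j + m.+1%:R^-1).
    by rewrite ltrBlDr -addrA ltrDl addr_gt0.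
  by rewrite in_itv/= => qx; exists q; rewrite distrC ltr_distl.
have [q qP] := choice hq.
exists (\row_j q j, m) => [j|y hy j]; first by rewrite /= mxE; exact: qP.
have := hy j; rewrite /= mxE => yq.
have -> : y 0 j - x 0 j = (y 0 j - ratr (q j)) - (x 0 j - ratr (q j)) by ring.
by apply: le_lt_trans (ler_normB _ _) _; apply: lt_trans (ltrD yq (qP j)) mr.
Qed.

(** As [q] ranges over the rational boxes, these points form a countable dense
    subset of [A], whatever the shape of [A]; [x0] fills in for the boxes that
    miss [A]. *)
Definition box_point A x0 (q : 'rV[rat]_n * nat) : 'rV[R]_n :=
  if pselect (exists x, A x /\ in_box q x) is left h then projT1 (cid h) else x0.

Lemma box_point_in A x0 q : A x0 -> A (box_point A x0 q).
Proof. by rewrite /box_point; case: pselect => // h _; case: cid => x []. Qed.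

Lemma box_point_dense A x0 x (r : R) : A x -> 0 < r ->
  exists q, forall j, `|box_point A x0 q 0 j - x 0 j| < r.
Proof.
move=> Ax r0; have [q qx qr] := in_box_small x r0; exists q; apply: qr.
rewrite /box_point; case: pselect => [h|[]]; last by exists x.
by case: cid => y [].
Qed.

End rational_boxes.

Section measurable_vectors.
Context {d} {T : measurableType d} {R : realType} {n : nat}.
Implicit Types z : T -> 'rV[R]_n.

Lemma measurable_le_set (f g : T -> R) :
  measurable_fun setT f -> measurable_fun setT g ->
  measurable [set w | f w <= g w].
Proof.
move=> mf mg; have := measurable_fun_ler mf mg measurableT (Y := [set true]).
by rewrite setTI; exact.
Qed.

Lemma measurable_lt_set (f g : T -> R) :
  measurable_fun setT f -> measurable_fun setT g ->
  measurable [set w | f w < g w].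
Proof.
move=> mf mg; have := measurable_fun_ltr mf mg measurableT (Y := [set true]).
by rewrite setTI; exact.
Qed.

Lemma countable_bigcapT_measurable (U : countType) (F : U -> set T) :
  (forall i, measurable (F i)) -> measurable (\bigcap_i F i).
Proof.
move=> mF; rewrite -[X in measurable X]setCK setC_bigcap; apply: measurableC.
apply: countable_bigcupT_measurable; first exact: countableP.
by move=> i; exact: measurableC.
Qed.

Lemma measurable_fun_le_sets (f : T -> R) :
  (forall a, measurable [set w | f w <= a]) -> measurable_fun setT f.
Proof.
move=> mf; apply: (measurability _ (RGenOInfty.measurableE R)) => _ [_ [a ->] <-].
rewrite setTI (_ : _ @^-1` _ = ~` [set w | f w <= a]); first exact: measurableC.
by apply/seteqP; split=> w /=; rewrite in_itv/= andbT ltNge => /negP.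
Qed.

Definition mvec z := forall j, measurable_fun setT (fun w => z w 0 j).

(** Open sets are countable unions of rational boxes. *)
Lemma mvec_borel z : mvec z -> measurable_fun setT (z : T -> borel_rV R n).
Proof.
move=> mz; apply: (@measurability _ _ T (borel_rV R n) _ _ (@open 'rV[R]_n) erefl) => _ [U oU <-].
rewrite setTI.
pose C := [set q : 'rV[rat]_n * nat | in_box q `<=` U].
rewrite (_ : z @^-1` U = \bigcup_(q in C) [set w | in_box q (z w)]); last first.
  apply/seteqP; split=> [w /= Uw|w [q Cq]]; last by move/Cq.
  have /nbhs_rV_box[r r0 rU] : nbhs (z w) U by exact: open_nbhs_nbhs.
  by have [q qz qr] := in_box_small (z w) r0; exists q => // y /qr/rU.
rewrite bigcup_mkcond; apply: countable_bigcupT_measurable; first exact: countableP.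
move=> q; case: ifPn => // _.
rewrite (_ : [set w | _] = \bigcap_(j : 'I_n)
    [set w | `|z w 0 j - ratr (q.1 0 j)| < q.2.+1%:R^-1]).
  apply: fin_bigcap_measurable => // j _; apply: measurable_lt_set => //.
  by apply: measurableT_comp => //; exact: measurable_funB.
by apply/seteqP; split=> w /= h j; [move=> _|]; apply: h.
Qed.

Lemma mvec_cst (u : 'rV[R]_n) : mvec (fun=> u).
Proof. by move=> j; exact: measurable_cst. Qed.

Lemma mvecD z1 z2 : mvec z1 -> mvec z2 -> mvec (fun w => z1 w + z2 w).
Proof.
by move=> m1 m2 j; under eq_fun do rewrite mxE; exact: measurable_funD.
Qed.

Lemma mvecZ (a : R) z : mvec z -> mvec (fun w => a *: z w).
Proof.
by move=> mz j; under eq_fun do rewrite mxE; exact: measurable_funM.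
Qed.

Lemma mvecB z1 z2 : mvec z1 -> mvec z2 -> mvec (fun w => z1 w - z2 w).
Proof.
by move=> m1 m2 j; under eq_fun do rewrite !mxE; exact: measurable_funB.
Qed.

Lemma mvec_dotp z1 z2 : mvec z1 -> mvec z2 ->
  measurable_fun setT (fun w => dotp (z1 w) (z2 w)).
Proof.
by move=> m1 m2; apply: measurable_sum => j; exact: measurable_funM.
Qed.

Section relatively_differentiable.
Variables (Z : set 'rV[R]_n) (f : 'rV[R]_n -> R) (gf : 'rV[R]_n -> 'rV[R]_n).
Hypotheses (cZ : convex_set Z) (fgf : gradient_on Z f gf).

(** [f] need not be measurable off [Z], but it is continuous along [Z]: the
    open set used is the interior of a strict upper level set extended by the
    complement of [Z]. *)
Lemma mvec_comp z : mvec z -> (forall w, Z (z w)) ->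
  measurable_fun setT (fun w => f (z w)).
Proof.
move=> mz Zz; apply: (measurability _ (RGenOInfty.measurableE R)) => _ [_ [a ->] <-].
rewrite setTI; pose U := [set y | Z y -> a < f y].
rewrite (_ : _ @^-1` _ = z @^-1` U°).
  rewrite -[X in measurable X]setTI; apply: (mvec_borel mz measurableT).
  by apply: sub_sigma_algebra; exact: open_interior.
apply/seteqP; split=> w /=; rewrite in_itv/= andbT; last first.
  by move/nbhs_singleton; apply.
move=> afz; have fz0 : 0 < f (z w) - a by rewrite subr_gt0.
have [r r0 hr] := gradient_on_continuous fgf (Zz w) fz0.
apply/nbhs_rV_box; exists r => // y yr Zy.
by have := hr y Zy yr; rewrite ltr_distlC => /andP[]; lra.
Qed.

Lemma mvec_gradient z y : mvec z -> mvec y -> (forall w, Z (z w)) ->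
  (forall w, Z (y w)) -> measurable_fun setT (fun w => dotp (gf (z w)) (y w - z w)).
Proof.
move=> mz my Zz Zy.
pose h m w := m.+1%:R * (f (z w + m.+1%:R^-1 *: (y w - z w)) - f (z w)).
apply: (@measurable_fun_cvg _ _ _ _ h) => [m|w _]; last first.
  exact: (gradient_on_limit cZ fgf (Zz w) (Zy w)).
apply: measurable_funM => //; apply: measurable_funB; last exact: mvec_comp.
apply: mvec_comp; first exact: mvecD mz (mvecZ _ (mvecB my mz)).
move=> w; apply: (convex_set_segment cZ) => //.
by rewrite invr_ge0 ler0n invf_le1 ?ltr0n// ler1n.
Qed.

Lemma mvec_bregman z y : mvec z -> mvec y -> (forall w, Z (z w)) ->
  (forall w, Z (y w)) -> measurable_fun setT (fun w => bregman f gf (z w) (y w)).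
Proof.
move=> mz my Zz Zy; apply: measurable_funB; last exact: mvec_gradient.
by apply: measurable_funB; exact: mvec_comp.
Qed.

End relatively_differentiable.

(** The [j]-th coordinate of the minimizer is at most [a] iff the infimum over
    [Z] is already approached on [Z] cut by that half-space; on countable dense
    subsets this is a countable Boolean combination of comparisons between
    values of the objective. *)
Lemma mvec_argmin (Z : set 'rV[R]_n) (phi : T -> 'rV[R]_n -> R) z :
  (forall y, Z y -> measurable_fun setT (phi ^~ y)) ->
  (forall w, is_argmin Z (phi w) (z w)) ->
  (forall w e, 0 < e -> exists2 r : R, 0 < r & forall y, Z y ->
     (forall j, `|y 0 j - z w 0 j| < r) -> `|phi w y - phi w (z w)| < e) ->
  (forall w, exists2 c : R, 0 < c & forall y, Z y ->
     c * dotp (y - z w) (y - z w) <= phi w y - phi w (z w)) ->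
  mvec z.
Proof.
move=> mphi zmin zcont zgrow j; apply: measurable_fun_le_sets => a.
pose Za := [set y | Z y /\ y 0 j <= a].
have [[ya Zya]|noZa] := pselect (exists y, Za y); last first.
  rewrite (_ : [set w | _] = set0)//.
  apply/seteqP; split=> // w /= za; apply: noZa.
  by exists (z w); split => //; have [] := zmin w.
pose u := box_point Za ya; pose v := box_point Z ya.
have Zu q : Za (u q) := box_point_in q Zya.
have Zv q : Z (v q) := box_point_in q Zya.1.
rewrite (_ : [set w | _] = \bigcap_(m : nat) \bigcap_(q : 'rV[rat]_n * nat)
    \bigcup_(q' : 'rV[rat]_n * nat)
    [set w | phi w (u q') <= phi w (v q) + m.+1%:R^-1]); last first.
  apply/seteqP; split=> [w /= za m _ q _|w /= h].
    have m0 : 0 < m.+1%:R^-1 :> R by rewrite invr_gt0 ltr0n.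
    have [r r0 hr] := zcont w _ m0.
    have [Zz zm] := zmin w.
    have [q' hq'] := @box_point_dense _ _ Za ya (z w) r (conj Zz za) r0.
    exists q' => //=; have := hr _ (Zu q').1 hq'; rewrite ltr_distl => /andP[_].
    by move=> /ltW/le_trans; apply; rewrite lerD2r; exact: zm.
  have [Zz zm] := zmin w; have [c c0 hc] := zgrow w.
  apply/ler_addgt0Pr => e e0.
  pose m := Num.bound (2 / (c * e ^+ 2)).
  have ce : 0 < c * e ^+ 2 by rewrite mulr_gt0 ?exprn_gt0.
  have m0 : 0 < m.+1%:R^-1 :> R by rewrite invr_gt0 ltr0n.
  have mr : m.+1%:R^-1 + m.+1%:R^-1 < c * e ^+ 2.
    rewrite -mulr2n -[X in X < _]mulr_natl ltr_pdivrMr ?ltr0n// mulrC -ltr_pdivrMr//.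
    apply: lt_trans (archi_boundP _) _; first by rewrite divr_ge0// ltW.
    by rewrite ltr_nat.
  have [r r0 hr] := zcont w _ m0.
  have [q hq] := @box_point_dense _ _ Z ya (z w) r Zz r0.
  have [q' _ /= huv] := h m I q I.
  have := hr _ (Zv q) hq; rewrite ltr_distl => /andP[_ hv].
  have hu := hc _ (Zu q').1; have [_ ua] := Zu q'.
  have := le_trans hu (_ : _ <= m.+1%:R^-1 + m.+1%:R^-1).
  have -> : phi w (u q') - phi w (z w) <= m.+1%:R^-1 + m.+1%:R^-1.
    by move: huv hv; move: (m.+1%:R^-1 : R) => t; lra.
  move=> /(_ isT)/le_lt_trans/(_ mr); rewrite ltr_pM2l// => hsq.
  have := le_lt_trans (sqr_coord_le (u q' - z w) j) hsq.
  rewrite !mxE leNgt => hcoord; apply/negP => ez.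
  have : e < z w 0 j - u q' 0 j by lra.
  move: hcoord; rewrite -sqrrN opprB; move: (z w 0 j - _) => t; nra.
apply: bigcapT_measurable => m; apply: countable_bigcapT_measurable => q.
apply: countable_bigcupT_measurable; first exact: countableP.
move=> q'; apply: measurable_le_set; first exact: mphi (Zu q').1.
by apply: measurable_funD => //; exact: mphi.
Qed.

End measurable_vectors.

(** * Square-integrable variables and conditionally centred noise *)

Section square_integrable.
Context {d} {T : measurableType d} {R : realType} (mu : {measure set T -> \bar R}).
Implicit Types f g : T -> R.

Definition sqint f := measurable_fun setT f /\
  mu.-integrable setT (fun w => (f w ^+ 2)%:E).

Lemma sqint_mul f g : sqint f -> sqint g ->
  mu.-integrable setT (fun w => (f w * g w)%:E).
Proof.
move=> [mf f2] [mg g2].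
apply: (le_integrable measurableT) (integrableD measurableT f2 g2).
  by apply/measurable_EFinP; exact: measurable_funM.
move=> w _ /=; rewrite lee_fin [leRHS]ger0_norm ?addr_ge0 ?sqr_ge0//.
rewrite ler_norml; have := sqr_ge0 (f w + g w); have := sqr_ge0 (f w - g w).
have := sqr_ge0 (f w); have := sqr_ge0 (g w).
rewrite !expr2; move: (f w) (g w) => x y; nra.
Qed.

(** A finite value of the integral of a real function implies integrability:
    an infinite negative part would force the value to be [-oo]. *)
Lemma integrable_of_fin_integral f r : measurable_fun setT f ->
  (\int[mu]_w (f w)%:E = r%:E)%E -> mu.-integrable setT (EFin \o f).
Proof.
move=> mf; rewrite integralE; set p := (\int[mu]_w _)%E; set q := (\int[mu]_w _)%E.
move=> pq.
have p0 : (0 <= p)%E by apply: integral_ge0.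
have q0 : (0 <= q)%E by apply: integral_ge0.
have mfE : measurable_fun setT (EFin \o f) by exact/measurable_EFinP.
apply/integrableP; split => //.
rewrite (_ : (fun w => _) = (EFin \o f)^\+ \+ (EFin \o f)^\-)%E; last first.
  by rewrite -fune_abse.
rewrite ge0_integralD//; last 2 first.
- exact: measurable_funepos.
- exact: measurable_funeneg.
rewrite -/p -/q; move: p q p0 q0 pq => [p| |] [q| |]//= _ _ _.
by rewrite -EFinD ltry.
Qed.

End square_integrable.

(** As [measurable_fubini_F], without integrability on the product. *)
Lemma measurable_section_integral (d1 d2 : measure_display)
    (T1 : measurableType d1) (T2 : measurableType d2) (R : realType)
    (m2 : {sigma_finite_measure set T2 -> \bar R}) (f : T1 * T2 -> \bar R) :
  measurable_fun setT f -> measurable_fun setT (fun x => \int[m2]_y f (x, y))%E.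
Proof.
move=> mf; under eq_fun do rewrite integralE.
have mp := @measurable_fun_fubini_tonelli_F _ _ T1 T2 R m2 _
  (measurable_funepos mf) (funepos_ge0 f).
have mn := @measurable_fun_fubini_tonelli_F _ _ T1 T2 R m2 _
  (measurable_funeneg mf) (funeneg_ge0 f).
rewrite (_ : (fun x => _) = fubini_F m2 f^\+ \- fubini_F m2 f^\-)%E.
  exact: emeasurable_funB mp mn.
apply/funext => x; congr (_ - _)%E; apply: eq_integral => y _.
  by rewrite funepos_comp.
by rewrite funeneg_comp.
Qed.

Section noise.
Context {R : realType} {dO dS : measure_display} {Omega : measurableType dO}
  {Xi : measurableType dS} {P : probability Omega R} {I : choiceType} {n : nat}.
Variable X : I -> {mfun Omega >-> Xi}.
Variable D : set I.
Hypothesis indep : independent_on P D (fun i => X i : Omega -> Xi).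
Variables (B : set I) (i : I).
Hypotheses (BD : B `<=` D) (Di : D i) (Bi : ~ B i).
Variables (Z : set 'rV[R]_n) (calH : 'rV[R]_n -> Xi -> 'rV[R]_n)
  (H : 'rV[R]_n -> 'rV[R]_n) (sigma : R) (z : Omega -> 'rV[R]_n).
Hypotheses (clZ : closed Z) (mcalH : jointly_measurable Z calH).
Hypotheses (Zz : forall w, Z (z w)) (mz : mvec (z : past_type X B -> 'rV[R]_n)).
Notation mu := (distribution P (X i)).
Hypothesis unb : {ae P, forall w, unbiased_at mu calH H (z w)}.
Hypothesis var : {ae P, forall w, variance_le_at mu sigma calH H (z w)}.

(** Conditional mean given the past. It agrees with [H \o z] almost surely,
    but, unlike the latter, it is always measurable. *)
Definition cond_mean w : 'rV[R]_n :=
  \row_j fine (\int[mu]_s (calH (z w) s 0 j)%:E)%E.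

Definition centred w : 'rV[R]_n := calH (z w) (X i w) - cond_mean w.

Let closed_borel : measurable (Z : set (borel_rV R n)).
Proof.
rewrite -[Z]setCK; apply: measurableC; apply: sub_sigma_algebra.
by rewrite openC.
Qed.

Lemma estimate_measurable d (T : measurableType d) (y : T -> 'rV[R]_n) (s : T -> Xi) :
  mvec y -> (forall w, Z (y w)) -> measurable_fun setT s ->
  mvec (fun w => calH (y w) (s w)).
Proof.
move=> my Zy ms j.
have mZS : measurable ((Z : set (borel_rV R n)) `*` [set: Xi]).
  by apply: measurableX => //; exact: closed_borel.
apply: (@measurable_comp _ _ _ _ _ _
  ((Z : set (borel_rV R n)) `*` [set: Xi])
  (fun p : borel_rV R n * Xi => calH p.1 p.2 0 j) setT
  (fun w => (y w : borel_rV R n, s w))).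
- exact: mZS.
- by move=> _ [w _ <-]; split => //=; exact: Zy.
- exact: mcalH.
- by apply: measurable_fun_pair => //; exact: mvec_borel.
Qed.

Let past_estimate : mvec (fun p : past_type X B * Xi => calH (z p.1) p.2).
Proof.
apply: estimate_measurable => //.
by move=> j; exact: (measurableT_comp (mz j)).
Qed.

Let section_measurable w j : measurable_fun setT (fun s => calH (z w) s 0 j).
Proof.
have h := measurable_fun_pair2 (w : past_type X B) (past_estimate j).
exact: h.
Qed.

Lemma cond_mean_past : mvec (cond_mean : past_type X B -> 'rV[R]_n).
Proof.
move=> j; under eq_fun do rewrite mxE.
apply: (measurableT_comp (fine_measurable measurableT)).
have mf : measurable_fun setT
    (fun p : past_type X B * Xi => (calH (z p.1) p.2 0 j)%:E).
  by apply/measurable_EFinP; exact: past_estimate.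
exact: measurable_section_integral mf.
Qed.

Lemma cond_mean_ae : {ae P, forall w, cond_mean w = H (z w)}.
Proof.
by apply: filterS unb => w uw; apply/rowP => j; rewrite mxE uw.
Qed.

Lemma centred_past B' : B `<=` B' -> B' i ->
  mvec (centred : past_type X B' -> 'rV[R]_n).
Proof.
move=> BB' B'i; apply: mvecB; last first.
  by move=> j; exact: past_measurable_fun_le BB' (cond_mean_past j).
apply: estimate_measurable => //; last exact: past_sample_measurable.
by move=> j; exact: past_measurable_fun_le BB' (mz j).
Qed.

Lemma centred_measurable : mvec centred.
Proof.
move=> j; apply: (past_measurable_fun (B := B `|` [set i])).
by apply: centred_past; [exact: subsetUl|right].
Qed.

Let past_dev (p : past_type X B * Xi) := calH (z p.1) p.2 - cond_mean p.1.

Let past_dev_measurable : mvec past_dev.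
Proof.
apply: mvecB => // j.
exact: (measurableT_comp (cond_mean_past j)).
Qed.

Lemma centred_variance :
  (\int[P]_w (dotp (centred w) (centred w))%:E <= (sigma ^+ 2)%:E)%E.
Proof.
pose f p := (dotp (past_dev p) (past_dev p))%:E.
have mf : measurable_fun setT f by apply/measurable_EFinP; exact: mvec_dotp.
have f0 p : (0 <= f p)%E by rewrite lee_fin dotp_ge0.
rewrite (freezing_ge0 indep BD Di Bi mf f0).
apply: (@le_trans _ _ (\int[P]_w (cst (sigma ^+ 2)%:E w))%E); last first.
  by rewrite integral_cst// [X in (_ * X)%E]probability_setT mule1.
apply: ae_ge0_le_integral => //.
- by move=> w _; apply: integral_ge0.
- apply: (past_measurable_fun (X := X) (B := B)).
  exact: (measurable_fun_fubini_tonelli_F f).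
- by move=> w _; rewrite lee_fin sqr_ge0.
- apply: filterS2 cond_mean_ae var => w mw vw _.
  rewrite /f /past_dev /= mw; apply: le_trans vw.
  by under [leLHS]eq_integral do rewrite -l2norm_sqr.
Qed.

Lemma centred_sqint j : sqint P (fun w => centred w 0 j).
Proof.
have mc := centred_measurable j; split => //.
apply/integrableP; split.
  by apply/measurable_EFinP; exact: measurable_funX.
apply: le_lt_trans (ltry (sigma ^+ 2)); apply: le_trans centred_variance.
apply: ge0_le_integral => //.
- by apply: measurableT_comp => //; apply/measurable_EFinP; exact: measurable_funX.
- by apply/measurable_EFinP; apply: mvec_dotp; exact: centred_measurable.
- move=> w _; rewrite gee0_abs ?lee_fin ?sqr_ge0//; exact: sqr_coord_le.
Qed.

(** Orthogonality of the noise to the past, by integrating the fresh sample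
    first. *)
Lemma centred_orthogonal (Y : Omega -> R) j :
  measurable_fun setT (Y : past_type X B -> R) -> sqint P Y ->
  (\int[P]_w (centred w 0 j * Y w)%:E = 0)%E.
Proof.
move=> mY Y2.
pose f (p : past_type X B * Xi) := (past_dev p 0 j * Y p.1)%:E.
have mf : measurable_fun setT f.
  apply/measurable_EFinP; apply: measurable_funM => //.
  exact: (measurableT_comp mY).
rewrite (freezing indep BD Di Bi mf); last exact: sqint_mul (centred_sqint j) Y2.
rewrite (ae_eq_integral (cst 0%E)) ?integral0//; last first.
  apply: filterS2 cond_mean_ae unb => w mw uw _; rewrite /f /past_dev /= mw.
  have iw : mu.-integrable setT (fun s => (calH (z w) s 0 j)%:E).
    exact: (integrable_of_fin_integral (@section_measurable w j) (uw j)).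
  under eq_integral do rewrite !mxE mulrC EFinM EFinB.
  rewrite integralZl//; last first.
    by apply: integrableB => //; exact: finite_measure_integrable_cst.
  rewrite integralB//; last exact: finite_measure_integrable_cst.
  by rewrite uw integral_cst// [X in (_ - _ * X)%E]probability_setT mule1 subee// mule0.
apply: (past_measurable_fun (X := X) (B := B)).
exact: measurable_section_integral mf.
Qed.

End noise.

(** * The iterates are functions of the past samples *)

Lemma gradient_on_add_linear (R : realType) (n : nat) (Z : set 'rV[R]_n)
    (f : 'rV[R]_n -> R) (gf : 'rV[R]_n -> 'rV[R]_n) (xi : 'rV[R]_n) (c : R) :
  gradient_on Z f gf ->
  gradient_on Z (fun y => dotp xi y + c * f y) (fun y => xi + c *: gf y).
Proof.
move=> fgf x Zx e e0.
have c0 : 0 < 1 + `|c| by rewrite ltr_pwDl.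
have := fgf x Zx _ (divr_gt0 e0 c0); apply: filterS => y h.
rewrite dotpDl dotpZl.
have -> : dotp xi y + c * f y - (dotp xi x + c * f x) -
    (dotp xi (y - x) + c * dotp (gf x) (y - x)) =
    c * (f y - f x - dotp (gf x) (y - x)).
  by rewrite dotpDr dotpNr; ring.
have l0 : 0 <= l2norm (y - x) by rewrite sqrtr_ge0.
rewrite normrM; apply: le_trans (ler_wpM2l (normr_ge0 c) h) _.
rewrite mulrA ler_wpM2r// mulrCA ler_piMr ?(ltW e0)//.
by rewrite ler_pdivrMr// mul1r lerDr.
Qed.

Section prox_measurable.
Context {dT} {T : measurableType dT} {R : realType} {n : nat}.
Variables (Z : set 'rV[R]_n) (d : 'rV[R]_n -> R) (gradd : 'rV[R]_n -> 'rV[R]_n).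
Variables (G : 'rV[R]_n -> R) (gradG : 'rV[R]_n -> 'rV[R]_n).
Hypotheses (cZ : convex_set Z) (dprox : prox_function Z d gradd).
Hypothesis GgradG : gradient_on Z G gradG.

Lemma mvec_prox (beta eta : R) (low h a b z : T -> 'rV[R]_n) :
  0 <= beta -> 0 < eta -> mvec low -> mvec h -> mvec a -> mvec b ->
  (forall w, Z (low w)) -> (forall w, Z (a w)) -> (forall w, Z (b w)) ->
  (forall w, is_argmin Z
     (smps_obj d gradd beta eta (gradG (low w)) (h w) (a w) (b w)) (z w)) ->
  mvec z.
Proof.
move=> beta0 eta0 mlow mh ma mb Zlow Za Zb zmin.
(* The objective minus the constant [dotp (gradG low) low]: [gradG] is only
   known to be measurable in directions inside [Z]. *)
pose phi w y := dotp (gradG (low w)) (y - low w) + dotp (h w) y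
  + beta * bregman d gradd (a w) y + eta * bregman d gradd (b w) y.
have phiE w y y' : phi w y - phi w y' =
    smps_obj d gradd beta eta (gradG (low w)) (h w) (a w) (b w) y
    - smps_obj d gradd beta eta (gradG (low w)) (h w) (a w) (b w) y'.
  by rewrite /phi /smps_obj !(dotpDl, dotpDr, dotpNr); ring.
apply: (@mvec_argmin _ _ _ _ Z phi).
- move=> y Zy; have my := @mvec_cst _ T _ _ y.
  apply: measurable_funD; last first.
    by apply: measurable_funM => //; exact: (mvec_bregman cZ dprox.1).
  apply: measurable_funD; last first.
    by apply: measurable_funM => //; exact: (mvec_bregman cZ dprox.1).
  apply: measurable_funD; first exact: (mvec_gradient cZ GgradG).
  exact: mvec_dotp.
- move=> w; have [Zz zm] := zmin w; split => // y Zy.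
  by rewrite -subr_ge0 phiE subr_ge0; exact: zm.
- move=> w e e0; have [Zz _] := zmin w.
  pose xi := gradG (low w) + h w - beta *: gradd (a w) - eta *: gradd (b w).
  have gF := gradient_on_add_linear xi (beta + eta) dprox.1.
  have [r r0 hr] := gradient_on_continuous gF Zz e0.
  exists r => // y Zy yr; have := hr y Zy yr; rewrite phiE.
  rewrite (_ : _ - _ = smps_obj d gradd beta eta (gradG (low w)) (h w) (a w) (b w) y
    - smps_obj d gradd beta eta (gradG (low w)) (h w) (a w) (b w) (z w))//.
  rewrite /smps_obj /bregman /xi !(dotpDl, dotpDr, dotpNl, dotpNr, dotpZl).
  ring.
- move=> w; have [Zz _] := zmin w; exists ((beta + eta) / 2).
    by rewrite divr_gt0// ltr_wpDl.
  move=> y Zy; have := prox_three_point cZ dprox.1 (zmin w) Zy.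
  have := bregman_ge cZ dprox Zz Zy; set V := bregman d gradd (z w) y.
  set q := dotp (y - z w) _ => Vq tp.
  have be0 : 0 <= beta + eta by rewrite addr_ge0// ltW.
  have := ler_wpM2l be0 Vq.
  rewrite phiE /smps_obj; move: tp.
  rewrite -/V !(dotpDl, dotpDr, dotpNl, dotpNr).
  move: (bregman _ _ _ _) (bregman _ _ _ _) (bregman _ _ _ _) (bregman _ _ _ _).
  move=> x1 x2 x3 x4; lra.
Qed.

End prox_measurable.

Section iterates.
Context {R : realType} {n : nat} {dO dS : measure_display}
  {Omega : measurableType dO} {Xi : measurableType dS}.
Variables (Z : set 'rV[R]_n) (d : 'rV[R]_n -> R) (gradd : 'rV[R]_n -> 'rV[R]_n).
Variables (G : 'rV[R]_n -> R) (gradG : 'rV[R]_n -> 'rV[R]_n).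
Variables (z0 : 'rV[R]_n) (L : R) (N : nat) (T : nat -> nat).
Variables (calH : 'rV[R]_n -> Xi -> 'rV[R]_n) (X : nat * nat -> {mfun Omega >-> Xi}).
Variable it : Omega -> smps_iterates R n.
Hypotheses (clZ : closed Z) (cZ : convex_set Z) (Z0 : Z z0).
Hypothesis T_gt0 : forall k, (1 <= k <= N)%N -> (0 < T k)%N.
Hypotheses (dprox : prox_function Z d gradd) (GgradG : gradient_on Z G gradG).
Hypotheses (L0 : 0 < L) (mcalH : jointly_measurable Z calH).
Hypothesis run : forall w, smps_run Z d gradd gradG calH z0 N T
  (smps_beta L) (smps_gamma R) (smps_eta L T) (fun k s => X (k, s) w) (it w).
Notation D := (sample_indices N T).

(** Samples are drawn in the lexicographic order of their indices. *)
Definition before k s : set (nat * nat) :=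
  D `&` [set i | (i.1 < k)%N \/ i.1 = k /\ (i.2 < s)%N].

Lemma before_mono k s k' s' : (k < k')%N \/ k = k' /\ (s <= s')%N ->
  before k s `<=` before k' s'.
Proof.
move=> h [i j] [Dij]; rewrite /= => hij; split => //=.
case: h => [kk'|[<- ss']].
  by left; case: hij => [ik|[-> _]//]; exact: ltn_trans kk'.
by case: hij => [ik|[-> js]]; [left|right; split => //; exact: leq_trans ss'].
Qed.

Lemma before_next k s : before k s `<=` before k.+1 1.
Proof. by apply: before_mono; left. Qed.

Notation known k s z := (mvec (z : past_type X (before k s) -> 'rV[R]_n)).

Lemma known_mono k s k' s' (z : Omega -> 'rV[R]_n) :
  before k s `<=` before k' s' -> known k s z -> known k' s' z.
Proof. by move=> h mz j; exact: past_measurable_fun_le h (mz j). Qed.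

Lemma known_inner k t : (1 <= k <= N)%N ->
  known k 1 (fun w => z_outer (it w) k.-1) -> known k 1 (fun w => z_bar (it w) k.-1) ->
  (t <= T k)%N ->
  known k (2 * t).+1 (fun w => z_in (it w) k t) /\
  ((0 < t)%N -> known k (2 * t) (fun w => z_tilde (it w) k t)).
Proof.
move=> kN mo mb; have k0 : (0 < k)%N by case/andP: kN.
have mlow : known k 1 (fun w => z_low (it w) k).
  rewrite (_ : (fun w => _) = fun w =>
     (1 - smps_gamma R k) *: z_bar (it w) k.-1 + smps_gamma R k *: z_outer (it w) k.-1).
    by apply: mvecD; exact: mvecZ.
  by apply/funext => w; have [_ _ /(_ k kN)[-> _ _ _ _]] := run w.
elim: t => [_|t IH tT].
  split => //; rewrite muln0 (_ : (fun w => _) = fun w => z_outer (it w) k.-1)//.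
  by apply/funext => w; have [_ _ /(_ k kN)[_ -> _ _ _]] := run w.
have [mt _] := IH (ltnW tT).
have tT' : (1 <= t.+1 <= T k)%N by [].
have D1 : D (k, (2 * t).+1) by split => //=; rewrite ltn_mul2l.
have D2 : D (k, (2 * t).+2) by split => //=; rewrite -[_.+2]/((2 + 2 * t)%N) -mulnS leq_mul2l.
have beta0 : 0 <= smps_beta L k by rewrite divr_ge0// mulr_ge0// ltW.
have eta0 : 0 < smps_eta L T k t.+1.
  apply: ltr_wpDl; first by rewrite mulr_ge0// subr_ge0 ler1n.
  by rewrite divr_gt0 ?mulr_gt0 ?ltr0n// T_gt0.
have Zlow w : Z (z_low (it w) k) := z_low_in cZ Z0 T_gt0 (run w) kN.
have Zo w : Z (z_outer (it w) k.-1).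
  have [] // := z_outer_bar_in cZ Z0 T_gt0 (run w) (k := k.-1).
  by case/andP: kN => _; exact: leq_trans (leq_pred k).
have Zt w : Z (z_in (it w) k t) := z_in_prev_in cZ Z0 T_gt0 (run w) kN tT'.
have tilde : known k (2 * t).+2 (fun w => z_tilde (it w) k t.+1).
  apply: (mvec_prox (T := past_type X (before k (2 * t).+2)) cZ dprox GgradG beta0 eta0
    (low := fun w => z_low (it w) k)
    (h := fun w => calH (z_in (it w) k t) (X (k, (2 * t).+1) w))
    (a := fun w => z_outer (it w) k.-1) (b := fun w => z_in (it w) k t)) => //.
  - by apply: known_mono mlow; apply: before_mono; right.
  - apply: (estimate_measurable clZ mcalH) => //.
      by apply: known_mono mt; apply: before_mono; right.
    by apply: past_sample_measurable; split => //; right.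
  - by apply: known_mono mo; apply: before_mono; right.
  - by apply: known_mono mt; apply: before_mono; right.
  move=> w; have [_ _ /(_ k kN)[_ _ /(_ t.+1 tT')[+ _] _ _]] := run w.
  by rewrite mulnS.
have Ztl w : Z (z_tilde (it w) k t.+1) := (z_inner_in (run w) kN tT').2.
rewrite mulnS; split => // {IH}.
apply: (mvec_prox (T := past_type X (before k (2 * t).+3)) cZ dprox GgradG beta0 eta0
    (low := fun w => z_low (it w) k)
    (h := fun w => calH (z_tilde (it w) k t.+1) (X (k, (2 * t).+2) w))
    (a := fun w => z_outer (it w) k.-1) (b := fun w => z_in (it w) k t)) => //.
- by apply: known_mono mlow; apply: before_mono; right.
- apply: (estimate_measurable clZ mcalH) => //.
    by apply: known_mono tilde; apply: before_mono; right.
  by apply: past_sample_measurable; split => //; right.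
- by apply: known_mono mo; apply: before_mono; right.
- by apply: known_mono mt; apply: before_mono; right; split => //; exact/leqW.
move=> w; have [_ _ /(_ k kN)[_ _ /(_ t.+1 tT')[_ +] _ _]] := run w.
by rewrite mulnS.
Qed.

Lemma known_outer k : (k <= N)%N ->
  known k.+1 1 (fun w => z_outer (it w) k) /\ known k.+1 1 (fun w => z_bar (it w) k).
Proof.
elim: k => [_|k IH kN].
  rewrite (_ : (fun w => z_outer _ _) = fun=> z0); last first.
    by apply/funext => w; have [-> _ _] := run w.
  rewrite (_ : (fun w => z_bar _ _) = fun=> z0); last first.
    by apply/funext => w; have [_ -> _] := run w.
  by split; exact: mvec_cst.
have kN' : (1 <= k.+1 <= N)%N by [].
have [mo mb] := IH (ltnW kN).
have inner t := @known_inner k.+1 t kN' mo mb.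
split.
  rewrite (_ : (fun w => _) = fun w => z_in (it w) k.+1 (T k.+1)).
    by apply: known_mono (inner _ (leqnn _)).1; exact: before_next.
  by apply/funext => w; have [_ _ /(_ k.+1 kN')[_ _ _ -> _]] := run w.
rewrite (_ : (fun w => _) = fun w => (1 - smps_gamma R k.+1) *: z_bar (it w) k +
    smps_gamma R k.+1 *: ((T k.+1)%:R^-1 *:
    \sum_(t < T k.+1) z_tilde (it w) k.+1 t.+1)); last first.
  apply/funext => w; have [_ _ /(_ k.+1 kN')[_ _ _ _ ->]] := run w.
  by rewrite big_add1 big_mkord.
apply: mvecD; first by apply: mvecZ; apply: known_mono mb; exact: before_next.
apply/mvecZ/mvecZ => j.
under eq_fun do rewrite summxE.
apply: measurable_sum => t.
have := (inner t.+1 (ltn_ord t)).2 isT.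
by move=> /(known_mono (@before_next _ _))/(_ j).
Qed.

Lemma known_tilde k t : (1 <= k <= N)%N -> (1 <= t <= T k)%N ->
  known k (2 * t) (fun w => z_tilde (it w) k t).
Proof.
case: k => [//|k] kN /andP[t0 tT].
have [mo mb] := known_outer (ltnW (kN : (k < N)%N)).
exact: (known_inner kN mo mb tT).2.
Qed.

Lemma known_in_prev k t : (1 <= k <= N)%N -> (1 <= t <= T k)%N ->
  known k (2 * t).-1 (fun w => z_in (it w) k t.-1).
Proof.
case: k => [//|k] kN; case: t => [//|t] /andP[_ tT].
have [mo mb] := known_outer (ltnW (kN : (k < N)%N)).
by rewrite mulnS; exact: (known_inner kN mo mb (ltnW tT)).1.
Qed.

End iterates.

(** * Expectations of sums *)

Section expectation_sums.
Import HBNNSimple.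
Context {dT} {T : measurableType dT} {R : realType} (mu : {measure set T -> \bar R}).
Notation integ f := (mu.-integrable setT (EFin \o f)).
Notation mean f := (\int[mu]_w f w).

Lemma integrable_comb (a b : R) (f g : T -> R) : integ f -> integ g ->
  integ (fun w => a * f w + b * g w) /\
  mean (fun w => a * f w + b * g w) = a * mean f + b * mean g.
Proof.
move=> hf hg.
have haf : integ (fun w => a * f w) by exact: (integrableZl measurableT a hf).
have hbg : integ (fun w => b * g w) by exact: (integrableZl measurableT b hg).
split; first exact: (integrableD measurableT haf hbg).
by rewrite RintegralD// !RintegralZl.
Qed.

Lemma integrable_wsum (I : eqType) (l : seq I) (a : I -> R) (F : I -> T -> R) :
  (forall i, i \in l -> integ (F i)) ->
  integ (fun w => \sum_(i <- l) a i * F i w) /\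
  mean (fun w => \sum_(i <- l) a i * F i w) = \sum_(i <- l) a i * mean (F i).
Proof.
elim: l => [_|i l IH hF].
  under eq_fun do rewrite big_nil.
  by rewrite big_nil; split; [exact: integrable0|rewrite /Rintegral integral0].
have [h1 h2] : integ (fun w => \sum_(i <- l) a i * F i w) /\
    mean (fun w => \sum_(i <- l) a i * F i w) = \sum_(i <- l) a i * mean (F i).
  by apply: IH => j jl; apply: hF; rewrite inE jl orbT.
have [g1 g2] := integrable_comb (a i) 1 (hF i (mem_head _ _)) h1.
have E : (fun w => \sum_(j <- i :: l) a j * F j w) =
    (fun w => a i * F i w + 1 * \sum_(i <- l) a i * F i w).
  by apply/funext => w; rewrite big_cons mul1r.
by rewrite E; split => //; rewrite g2 h2 big_cons mul1r.
Qed.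

Variable n : nat.

Definition vsqint (D : T -> 'rV[R]_n) := forall j, sqint mu (fun w => D w 0 j).

Lemma integrable_dotp (D E : T -> 'rV[R]_n) : vsqint D -> vsqint E ->
  integ (fun w => dotp (D w) (E w)) /\
  mean (fun w => dotp (D w) (E w)) = \sum_j mean (fun w => D w 0 j * E w 0 j).
Proof.
move=> hD hE.
have [|h1 h2] := @integrable_wsum _ (index_enum 'I_n) (fun=> 1)
    (fun j w => D w 0 j * E w 0 j).
  by move=> j _; exact: sqint_mul (hD j) (hE j).
have EE : (fun w => dotp (D w) (E w)) =
    (fun w => \sum_(j <- index_enum 'I_n) 1 * (D w 0 j * E w 0 j)).
  by apply/funext => w; apply: eq_bigr => j _; rewrite mul1r.
by rewrite EE; split => //; rewrite h2; apply: eq_bigr => j _; rewrite mul1r.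
Qed.

(** Pythagoras: for pairwise orthogonal summands the second moments add up. *)
Lemma orthogonal_sum_bound (I : eqType) (l : seq I) (D : I -> T -> 'rV[R]_n)
    (a : I -> R) (s : R) : uniq l ->
  (forall i, i \in l -> vsqint (D i)) ->
  (forall i j, i \in l -> j \in l -> i != j ->
     mean (fun w => dotp (D i w) (D j w)) = 0) ->
  (forall i, i \in l -> mean (fun w => dotp (D i w) (D i w)) <= s) ->
  let S w := \sum_(i <- l) a i *: D i w in
  integ (fun w => dotp (S w) (S w)) /\
  mean (fun w => dotp (S w) (S w)) <= \sum_(i <- l) a i ^+ 2 * s.
Proof.
move=> ul hD orth hs S.
have SE : (fun w => dotp (S w) (S w)) =
    (fun w => \sum_(i <- l) a i * \sum_(j <- l) a j * dotp (D i w) (D j w)).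
  apply/funext => w; rewrite dotp_suml; apply: eq_bigr => i _.
  rewrite dotpZl dotp_sumr; congr (_ * _); apply: eq_bigr => j _.
  by rewrite dotpZr.
have inner i : i \in l -> integ (fun w => \sum_(j <- l) a j * dotp (D i w) (D j w)) /\
    mean (fun w => \sum_(j <- l) a j * dotp (D i w) (D j w)) =
    \sum_(j <- l) a j * mean (fun w => dotp (D i w) (D j w)).
  move=> il; apply: (@integrable_wsum _ l a (fun j w => dotp (D i w) (D j w))) => j jl.
  by have [] := integrable_dotp (hD i il) (hD j jl).
have [|h1 h2] := @integrable_wsum _ l a
    (fun i w => \sum_(j <- l) a j * dotp (D i w) (D j w)).
  by move=> i il; have [] := inner i il.
rewrite SE; split => //; rewrite h2 !big_seq; apply: ler_sum => i il.
rewrite (inner i il).2 (bigD1_seq i)//= [X in _ + X]big1_seq => [|j /andP[ji jl]].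
  by rewrite addr0 mulrA -expr2 ler_wpM2l ?sqr_ge0// hs.
by rewrite orth ?mulr0// eq_sym.
Qed.

(** The integral of a nonnegative function is a supremum over simple functions
    below it, so it is monotone even when the function is not measurable. *)
Lemma ge0_integral_le_ae (f : T -> \bar R) (g : T -> R) :
  (forall w, 0 <= f w)%E -> integ g -> {ae mu, forall w, (f w <= (g w)%:E)%E} ->
  (\int[mu]_w f w <= \int[mu]_w (g w)%:E)%E.
Proof.
move=> f0 ig fg.
have mg : measurable_fun setT (EFin \o g) by exact: measurable_int ig.
rewrite ge0_integralTE//; apply: ge_ereal_sup => _ [h /= hf <-].
have -> : (\int[mu]_w (g w)%:E = \int[mu]_w (EFin \o g)^\+ w)%E.
  apply: ae_eq_integral => //; first exact: measurable_funepos.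
  apply: filterS fg => w fgw _; rewrite funeposE.
  by rewrite max_l//; exact: le_trans (f0 w) fgw.
have -> : sintegral mu h = (\int[mu]_w (h w)%:E)%E.
  by rewrite integral_nnsfun// patch_setT.
apply: ae_ge0_le_integral => //.
- by move=> w _; rewrite lee_fin.
- exact/measurable_EFinP.
- exact: measurable_funepos.
- apply: filterS fg => w fgw _; apply: le_trans (hf w) _; apply: le_trans fgw _.
  by rewrite funeposE le_max lexx.
Qed.

Lemma ae_all_seq (I : eqType) (l : seq I) (Q : I -> T -> Prop) :
  (forall i, i \in l -> {ae mu, forall w, Q i w}) ->
  {ae mu, forall w, forall i, i \in l -> Q i w}.
Proof.
elim: l => [_|i l IH hQ]; first by apply: aeW.
have h1 := hQ i (mem_head _ _).
have h2 : {ae mu, forall w, forall i, i \in l -> Q i w}.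
  by apply: IH => j jl; apply: hQ; rewrite inE jl orbT.
apply: filterS2 h1 h2 => w q1 q2 j; rewrite inE => /orP[/eqP->//|]; exact: q2.
Qed.

End expectation_sums.

(** * The expected gap *)

Section expected_gap.
Context {R : realType} {n : nat} {dO dS : measure_display}
  {Omega : measurableType dO} {Xi : measurableType dS} {P : probability Omega R}.
Variables (Z : set 'rV[R]_n) (d : 'rV[R]_n -> R) (gradd H : 'rV[R]_n -> 'rV[R]_n).
Variables (G : 'rV[R]_n -> R) (gradG : 'rV[R]_n -> 'rV[R]_n).
Variables (z0 : 'rV[R]_n) (M delta sigma L Om2 : R) (N : nat) (T : nat -> nat).
Variables (calH : 'rV[R]_n -> Xi -> 'rV[R]_n) (X : nat * nat -> {mfun Omega >-> Xi}).
Variable it : Omega -> smps_iterates R n.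
Hypotheses (clZ : closed Z) (cZ : convex_set Z) (Z0 : Z z0).
Hypothesis T_gt0 : forall k, (1 <= k <= N)%N -> (0 < T k)%N.
Hypotheses (dprox : prox_function Z d gradd) (Gsm : convex_smooth_on L Z G gradG).
Hypotheses (L0 : 0 < L) (mcalH : jointly_measurable Z calH).
Hypotheses (Hmono : monotone_on Z H) (Hsm : delta_smooth_on M delta Z H).
Hypothesis V_le : forall z, Z z -> bregman d gradd z0 z <= Om2.
Hypothesis N_gt0 : (0 < N)%N.
Hypothesis T_large : forall k, (1 <= k <= N)%N ->
  3 * M * k%:R <= 2 * L * (T k)%:R.
Hypothesis T_var : forall k, (1 <= k <= N)%N ->
  N%:R * k%:R ^+ 2 * sigma ^+ 2 <= (T k)%:R * (Om2 * L ^+ 2).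
Hypothesis run : forall w, smps_run Z d gradd gradG calH z0 N T
  (smps_beta L) (smps_gamma R) (smps_eta L T) (fun k s => X (k, s) w) (it w).
Notation D := (sample_indices N T).
Hypothesis indep : independent_on P D (fun i => X i : Omega -> Xi).
Hypothesis oracle : forall k t, (1 <= k <= N)%N -> (1 <= t <= T k)%N ->
  {ae P, forall w,
    [/\ unbiased_at (distribution P (X (k, (2 * t).-1%N))) calH H
          (z_in (it w) k t.-1),
        unbiased_at (distribution P (X (k, (2 * t)%N))) calH H (z_tilde (it w) k t),
        variance_le_at (distribution P (X (k, (2 * t).-1%N))) sigma calH H
          (z_in (it w) k t.-1) &
        variance_le_at (distribution P (X (k, (2 * t)%N))) sigma calH H
          (z_tilde (it w) k t)]}.
Notation integ f := (P.-integrable setT (EFin \o f)).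
Notation mean f := (\int[P]_w f w).
Notation past k s := (before N T k s).

Definition inner_steps : seq (nat * nat) :=
  [seq (k, t) | k <- index_iota 1 N.+1, t <- index_iota 1 (T k).+1].

Let inner_stepsP i : i \in inner_steps -> (1 <= i.1 <= N)%N /\ (1 <= i.2 <= T i.1)%N.
Proof.
by move=> /allpairsPdep[k [t [+ + ->]]]; rewrite !mem_index_iota !ltnS.
Qed.

Let uniq_inner_steps : uniq inner_steps.
Proof.
apply: allpairs_uniq_dep; [exact: iota_uniq|by move=> k _; exact: iota_uniq|].
by move=> [k t] [k' t'] _ _ /= [-> ->].
Qed.

(** Noises of the two oracle calls of inner step [i], centred at their
    conditional means rather than at [H], which need not be measurable. *)
Definition dev1 (i : nat * nat) : Omega -> 'rV[R]_n :=
  centred (P := P) X (i.1, (2 * i.2).-1) calH (fun w => z_in (it w) i.1 i.2.-1).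

Definition dev2 (i : nat * nat) : Omega -> 'rV[R]_n :=
  centred (P := P) X (i.1, (2 * i.2)%N) calH (fun w => z_tilde (it w) i.1 i.2).

Let past_sub k s : past k s `<=` D. Proof. by move=> i []. Qed.

Let past_irr k s : ~ past k s (k, s).
Proof. by move=> [_ /= [|[_]]]; rewrite ltnn. Qed.

Let idx1 i : i \in inner_steps -> D (i.1, (2 * i.2).-1).
Proof.
move=> /inner_stepsP[iN /andP[t0 tT]]; split => //=.
case: i.2 t0 tT => [//|t] _ tT; rewrite mulnS /=.
by rewrite (leq_trans _ (leq_mul (leqnn 2) tT))// mulnS.
Qed.

Let idx2 i : i \in inner_steps -> D (i.1, (2 * i.2)%N).
Proof.
by move=> /inner_stepsP[iN /andP[t0 tT]]; split => //=; rewrite muln_gt0/= t0 leq_mul2l.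
Qed.

Let Zin i w : i \in inner_steps -> Z (z_in (it w) i.1 i.2.-1).
Proof. by move=> /inner_stepsP[kN tT]; exact: (z_in_prev_in cZ Z0 T_gt0 (run w)). Qed.

Let Ztl i w : i \in inner_steps -> Z (z_tilde (it w) i.1 i.2).
Proof. by move=> /inner_stepsP[kN tT]; exact: (z_inner_in (run w) kN tT).2. Qed.

Let known1 i : i \in inner_steps ->
  mvec ((fun w => z_in (it w) i.1 i.2.-1) : past_type X (past i.1 (2 * i.2).-1) -> _).
Proof.
move=> /inner_stepsP[kN tT].
exact: (known_in_prev clZ cZ Z0 T_gt0 dprox Gsm.1 L0 mcalH run).
Qed.

Let known2 i : i \in inner_steps ->
  mvec ((fun w => z_tilde (it w) i.1 i.2) : past_type X (past i.1 (2 * i.2)) -> _).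
Proof.
move=> /inner_stepsP[kN tT].
exact: (known_tilde clZ cZ Z0 T_gt0 dprox Gsm.1 L0 mcalH run).
Qed.

Let dev1_sqint i : i \in inner_steps -> vsqint P (dev1 i) /\
  (\int[P]_w (dotp (dev1 i w) (dev1 i w))%:E <= (sigma ^+ 2)%:E)%E.
Proof.
move=> il; have [kN tT] := inner_stepsP il.
have unb : {ae P, forall w, unbiased_at (distribution P (X (i.1, (2 * i.2).-1)))
    calH H (z_in (it w) i.1 i.2.-1)}.
  by apply: filterS (oracle kN tT) => w [].
have var : {ae P, forall w, variance_le_at (distribution P (X (i.1, (2 * i.2).-1)))
    sigma calH H (z_in (it w) i.1 i.2.-1)}.
  by apply: filterS (oracle kN tT) => w [].
split; first by move=> j; apply: (centred_sqint indep (@past_sub i.1 (2 * i.2).-1)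
  (idx1 il) (@past_irr _ _) clZ mcalH (fun w => Zin w il) (known1 il) unb var).
exact: (centred_variance indep (@past_sub i.1 (2 * i.2).-1)
  (idx1 il) (@past_irr _ _) clZ mcalH (fun w => Zin w il) (known1 il) unb var).
Qed.

Let unb2 i : i \in inner_steps ->
  {ae P, forall w, unbiased_at (distribution P (X (i.1, (2 * i.2)%N)))
    calH H (z_tilde (it w) i.1 i.2)}.
Proof.
by move=> /inner_stepsP[kN tT]; apply: filterS (oracle kN tT) => w [].
Qed.

Let var2 i : i \in inner_steps ->
  {ae P, forall w, variance_le_at (distribution P (X (i.1, (2 * i.2)%N)))
    sigma calH H (z_tilde (it w) i.1 i.2)}.
Proof.
by move=> /inner_stepsP[kN tT]; apply: filterS (oracle kN tT) => w [].
Qed.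

Let dev2_sqint i : i \in inner_steps -> vsqint P (dev2 i) /\
  (\int[P]_w (dotp (dev2 i w) (dev2 i w))%:E <= (sigma ^+ 2)%:E)%E.
Proof.
move=> il; split; first by move=> j; apply: (centred_sqint indep
  (@past_sub i.1 (2 * i.2)) (idx2 il) (@past_irr _ _) clZ mcalH
  (fun w => Ztl w il) (known2 il) (unb2 il) (var2 il)).
exact: (centred_variance indep (@past_sub i.1 (2 * i.2))
  (idx2 il) (@past_irr _ _) clZ mcalH (fun w => Ztl w il) (known2 il) (unb2 il) (var2 il)).
Qed.

Let dev2_orthogonal i (Y : Omega -> R) j : i \in inner_steps ->
  measurable_fun setT (Y : past_type X (past i.1 (2 * i.2)) -> R) -> sqint P Y ->
  mean (fun w => dev2 i w 0 j * Y w) = 0.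
Proof.
move=> il mY Y2; rewrite /Rintegral.
by rewrite (centred_orthogonal indep (@past_sub i.1 (2 * i.2)) (idx2 il)
  (@past_irr _ _) clZ mcalH (fun w => Ztl w il) (known2 il) (unb2 il) (var2 il)).
Qed.

Let mean_sqr_le (D' : Omega -> 'rV[R]_n) : vsqint P D' ->
  (\int[P]_w (dotp (D' w) (D' w))%:E <= (sigma ^+ 2)%:E)%E ->
  mean (fun w => dotp (D' w) (D' w)) <= sigma ^+ 2.
Proof.
move=> hD; have [iD _] := integrable_dotp hD hD.
by rewrite -lee_fin /Rintegral fineK//; exact: integrable_fin_num.
Qed.

(** Noises of distinct steps are orthogonal, since the earlier one is known when
    the later sample is drawn. *)
Let dev2_pairwise i i' : i \in inner_steps -> i' \in inner_steps -> i != i' ->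
  mean (fun w => dotp (dev2 i w) (dev2 i' w)) = 0.
Proof.
have ordered u v : u \in inner_steps -> v \in inner_steps ->
    (u.1 < v.1)%N \/ u.1 = v.1 /\ (u.2 < v.2)%N ->
    mean (fun w => dotp (dev2 v w) (dev2 u w)) = 0.
  move=> ul vl uv.
  rewrite (integrable_dotp (dev2_sqint vl).1 (dev2_sqint ul).1).2.
  apply: big1 => j _; apply: dev2_orthogonal => //; last exact: (dev2_sqint ul).1.
  apply: (centred_past clZ mcalH (fun w => Ztl w ul) (known2 ul)).
    apply: before_mono; case: uv => [|[-> uv]]; first by left.
    by right; split => //; rewrite leq_mul2l ltnW.
  split; first exact: idx2.
  by case: uv => [|[-> uv]]; [left|right; split => //=; rewrite ltn_mul2l].
move=> il i'l; rewrite -[i != i']/(~~ ((i.1 == i'.1) && (i.2 == i'.2))) negb_and.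
have comm : mean (fun w => dotp (dev2 i w) (dev2 i' w)) =
    mean (fun w => dotp (dev2 i' w) (dev2 i w)).
  by apply: eq_Rintegral => w _; rewrite dotpC.
case: (ltngtP i.1 i'.1) => /= [lt _|lt _|e].
- by rewrite comm; exact: (ordered _ _ il i'l (or_introl lt)).
- exact: (ordered _ _ i'l il (or_introl lt)).
- case: (ltngtP i.2 i'.2) => [lt _|lt _|_]; last by case/negP.
  + by rewrite comm; exact: (ordered _ _ il i'l (or_intror (conj e lt))).
  + exact: (ordered _ _ i'l il (or_intror (conj (esym e) lt))).
Qed.

Let dist_le z : Z z -> dotp (z - z0) (z - z0) <= 2 * Om2.
Proof. by move=> Zz; have := bregman_ge cZ dprox Z0 Zz; have := V_le Zz; lra. Qed.

Let shifted_sqint i : i \in inner_steps ->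
  vsqint P (fun w => z_tilde (it w) i.1 i.2 - z0).
Proof.
move=> il j; have mz : mvec ((fun w => z_tilde (it w) i.1 i.2 - z0) :
    past_type X (past i.1 (2 * i.2)) -> _).
  by apply: mvecB; [exact: known2|exact: mvec_cst].
have mz' := past_measurable_fun (mz j); split => //.
apply: (le_integrable measurableT (g := cst (2 * Om2)%:E)); last first.
- exact: finite_measure_integrable_cst.
- move=> w _; have h := dist_le (Ztl w il).
  rewrite /= lee_fin !ger0_norm ?sqr_ge0 ?(le_trans (dotp_ge0 _) h)//.
  exact: le_trans (sqr_coord_le _ j) h.
- by apply/measurable_EFinP; exact: measurable_funX.
Qed.

Let dev2_point i : i \in inner_steps ->
  mean (fun w => dotp (dev2 i w) (z_tilde (it w) i.1 i.2 - z0)) = 0.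
Proof.
move=> il; rewrite (integrable_dotp (dev2_sqint il).1 (shifted_sqint il)).2.
apply: big1 => j _; apply: (dev2_orthogonal (Y := fun w => (z_tilde (it w) i.1 i.2 - z0) 0 j)) => //.
  by apply: mvecB; [exact: known2|exact: mvec_cst].
exact: shifted_sqint.
Qed.

Let wt (i : nat * nat) : R := i.1%:R / (T i.1)%:R.
Let cf (i : nat * nat) : R := 3 * i.1%:R / (L * (T i.1)%:R).
Let S w := \sum_(i <- inner_steps) wt i *: dev2 i w.
Let local_err i w := cf i *
    (1 * dotp (dev1 i w) (dev1 i w) + 1 * dotp (dev2 i w) (dev2 i w))
  + -1 * dotp (dev2 i w) (z_tilde (it w) i.1 i.2 - z0).
Let total_err w := 1 * \sum_(i <- inner_steps) wt i * local_err i w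
  + (2 * L)^-1 * dotp (S w) (S w).

Let T_pos k : (1 <= k <= N)%N -> 0 < (T k)%:R :> R.
Proof. by move=> kN; rewrite ltr0n T_gt0. Qed.

(** The choice of [T_k] makes the variance contribution of every outer step
    at most of order [L Om2 / N]: 6 units come from the squared noises, one half
    from [S]. *)
Let variance_budget :
  \sum_(i <- inner_steps) (wt i * (cf i * (2 * sigma ^+ 2))
     + (2 * L)^-1 * (wt i ^+ 2 * sigma ^+ 2)) <= 13 / 2 * L * Om2.
Proof.
rewrite big_allpairs_dep/=.
have N0 : 0 < N%:R :> R by rewrite ltr0n.
apply: (@le_trans _ _ (\sum_(1 <= k < N.+1) (13 / 2 * L * Om2 / N%:R))); last first.
  by rewrite sumr_const_nat subn1 -[leLHS]mulr_natr /= divfK// gt_eqF.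
apply: ler_sum_nat => k; rewrite ltnS => kN.
have T0 := T_pos kN; have := T_var kN.
rewrite /wt /cf /= sumr_const_nat subn1 -[X in _ -> X <= _]mulr_natl /=.
move: T0; move: ((T k)%:R : R) => y y0 hv.
rewrite (_ : y * _ = 13 / 2 * (k%:R ^+ 2 * sigma ^+ 2 / (L * y))); last first.
  by field; rewrite !gt_eqF.
rewrite (_ : 13 / 2 * L * Om2 / N%:R = 13 / 2 * (L * Om2 / N%:R)); last by rewrite !mulrA.
rewrite ler_pM2l ?divr_gt0// ler_pdivrMr ?mulr_gt0// [leRHS]mulrAC ler_pdivlMr//.
move: hv; move: (N%:R : R) (k%:R : R) => u v; rewrite !expr2; lra.
Qed.

Let total_err_mean : integ total_err /\ mean total_err <= 13 / 2 * L * Om2.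
Proof.
have hloc i : i \in inner_steps ->
    integ (local_err i) /\ mean (local_err i) <= cf i * (2 * sigma ^+ 2).
  move=> il; have [s1 v1] := dev1_sqint il; have [s2 v2] := dev2_sqint il.
  have [i1 _] := integrable_dotp s1 s1; have [i2 _] := integrable_dotp s2 s2.
  have [i3 _] := integrable_dotp s2 (shifted_sqint il).
  have [i12 m12] := integrable_comb 1 1 i1 i2.
  have [il' ml] := integrable_comb (cf i) (-1) i12 i3.
  split => //; rewrite ml m12 dev2_point// mulr0 addr0.
  have [kN _] := inner_stepsP il.
  apply: ler_wpM2l; first by rewrite divr_ge0// mulr_ge0// ltW.
  have two (x y b : R) : x <= b -> y <= b -> 1 * x + 1 * y <= 2 * b.
    by move=> xb yb; rewrite !mul1r [leRHS]mulr_natl mulr2n lerD.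
  exact: two (mean_sqr_le s1 v1) (mean_sqr_le s2 v2).
have [|ie me] := @integrable_wsum _ _ _ P _ inner_steps wt local_err.
  by move=> i /hloc[].
have [||||iS mS] := @orthogonal_sum_bound _ _ _ P n _ inner_steps dev2 wt (sigma ^+ 2).
- exact: uniq_inner_steps.
- by move=> i /dev2_sqint[].
- exact: dev2_pairwise.
- by move=> i /dev2_sqint[s v]; exact: mean_sqr_le.
have [it' mt] := integrable_comb 1 (2 * L)^-1 ie iS.
split => //; rewrite mt me mul1r; apply: le_trans variance_budget.
rewrite big_split/= -mulr_sumr; apply: lerD.
  rewrite !big_seq; apply: ler_sum => i il.
  by rewrite ler_wpM2l ?divr_ge0//; have [] := hloc i il.
by rewrite ler_pM2l// invr_gt0 mulr_gt0.
Qed.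

(** Almost surely the noises of the run are the centred ones, and the only
    noise term depending on the comparison point is linear in it. *)
Let run_bound_ae : {ae P, forall w, forall z, Z z ->
  N%:R * N.+1%:R / 2 * (Qgap G H (z_bar (it w) N) z - delta)
    <= 4 * L * Om2 + total_err w}.
Proof.
have noise_eq : {ae P, forall w, forall i, i \in inner_steps ->
    noise1 H calH (fun k s => X (k, s) w) (it w) i.1 i.2 = dev1 i w /\
    noise2 H calH (fun k s => X (k, s) w) (it w) i.1 i.2 = dev2 i w}.
  apply: ae_all_seq => i il; have [kN tT] := inner_stepsP il.
  apply: filterS (oracle kN tT) => w [u1 u2 _ _]; split.
    rewrite /noise1 /dev1 /centred; congr (_ - _).
    by apply/rowP => j; rewrite mxE u1.
  rewrite /noise2 /dev2 /centred; congr (_ - _).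
  by apply/rowP => j; rewrite mxE u2.
apply: filterS noise_eq => w hw z Zz.
have := run_bound cZ Z0 T_gt0 (run w) dprox L0 T_large Hmono Hsm Gsm Zz.
move=> /le_trans; apply.
rewrite (_ : \sum_(1 <= k < N.+1) _ =
    \sum_(i <- inner_steps) wt i * local_err i w + dotp (S w) (z - z0)); last first.
  rewrite /S dotp_suml -big_split/= big_allpairs_dep/=.
  apply: eq_big_nat => k; rewrite ltnS => kN.
  rewrite mulr_sumr; apply: eq_big_nat => t; rewrite ltnS => tT.
  have il : (k, t) \in inner_steps.
    by apply/allpairsPdep; exists k, t; rewrite !mem_index_iota !ltnS.
  have [/= n1 n2] := hw _ il.
  rewrite /step_noise n1 n2 /local_err /wt /cf /= dotpZl.
  rewrite -/(wt (k, t)) !(dotpDr, dotpNr); ring.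
have := V_le Zz; have := dotp_young (S w) (z - z0) L0; have := dist_le Zz.
rewrite /total_err; set q := dotp (z - z0) _; set s := dotp (S w) (S w).
move=> h1 h2 h3.
have h4 : L / 2 * q <= L / 2 * (2 * Om2) by rewrite ler_pM2l// divr_gt0.
have h5 : 3 * L * bregman d gradd z0 z <= 3 * L * Om2 by rewrite ler_pM2l// mulr_gt0.
rewrite [(2 * L)^-1 * s]mulrC; lra.
Qed.

Lemma expected_gap_le :
  (\int[P]_w ereal_sup [set (Qgap G H (z_bar (it w) N) z)%:E | z in Z]
     <= (21 * L * Om2 / (N%:R * N.+1%:R) + delta)%:E)%E.
Proof.
set kappa : R := N%:R * N.+1%:R / 2.
have kappa0 : 0 < kappa by rewrite divr_gt0 ?mulr_gt0 ?ltr0n.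
have [ie me] := total_err_mean.
have ic : integ (cst (delta + kappa^-1 * (4 * L * Om2)) : Omega -> R).
  exact: finite_measure_integrable_cst.
have [ig mg] := integrable_comb 1 kappa^-1 ic ie.
apply: le_trans (ge0_integral_le_ae _ ig _) _.
- move=> w; have [_ Zb] := z_outer_bar_in cZ Z0 T_gt0 (run w) (leqnn N).
  apply: ereal_sup_ubound; exists (z_bar (it w) N) => //.
  by rewrite /Qgap !subrr dotp0r addr0.
- apply: filterS run_bound_ae => w hw; apply: ge_ereal_sup => _ [z Zz <-].
  rewrite lee_fin; have := hw z Zz; rewrite -/kappa mulrC -ler_pdivlMr//.
  by rewrite /= mul1r mulrC; lra.
have -> : (\int[P]_w (1 * cst (delta + kappa^-1 * (4 * L * Om2)) w
    + kappa^-1 * total_err w)%:E)%E =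
  (mean (fun w => 1 * cst (delta + kappa^-1 * (4 * L * Om2)) w
    + kappa^-1 * total_err w))%:E.
  by rewrite /Rintegral fineK//; exact: integrable_fin_num.
rewrite lee_fin mg Rintegral_cst// [X in fine X]probability_setT mulr1 mul1r.
have := ler_wpM2l (_ : 0 <= kappa^-1) me; rewrite invr_ge0 (ltW kappa0) => /(_ isT).
have -> : 21 * L * Om2 / (N%:R * N.+1%:R) = kappa^-1 * (21 / 2 * L * Om2).
  rewrite /kappa; have : 0 < N%:R :> R by rewrite ltr0n.
  have : 0 < N.+1%:R :> R by rewrite ltr0n.
  by move: (N%:R : R) (N.+1%:R : R) => x y y0 x0; field; rewrite !gt_eqF.
move: (kappa^-1) => y; lra.
Qed.

End expected_gap.

(** * Parameters and complexity *)

Lemma natr_absz_ceil (R : realType) (x : R) : 0 < x ->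
  [/\ (0 < `|Num.ceil x|)%N, x <= `|Num.ceil x|%:R & `|Num.ceil x|%:R <= x + 1].
Proof.
move=> x0; have c0 : 0 < Num.ceil x by rewrite ceil_gt0.
rewrite absz_gt0 gt_eqF//; split => //.
  by rewrite natr_absz gtr0_norm// ceil_ge.
rewrite natr_absz gtr0_norm// -lerBlDr.
by have := ceilB1_lt x; rewrite intrB => /ltW.
Qed.

Section parameters.
Context {R : realType}.
Variables (M L sigma Om2 : R) (N : nat).
Hypotheses (M0 : 0 < M) (L0 : 0 < L) (Om0 : 0 < Om2).
Notation T := (smps_T L M sigma Om2 N).

Let variance_term (k : nat) :
  0 <= N%:R * k%:R ^+ 2 * sigma ^+ 2 / (Om2 * L ^+ 2).
Proof.
apply: divr_ge0; last by apply: mulr_ge0; [exact: ltW|exact: sqr_ge0].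
by apply: mulr_ge0 (sqr_ge0 _); apply: mulr_ge0 (sqr_ge0 _); exact: ler0n.
Qed.

Let smoothness_term (k : nat) : (0 < k)%N -> 0 < Num.sqrt 3 * k%:R * M / L.
Proof. by move=> k0; rewrite divr_gt0 ?mulr_gt0 ?sqrtr_gt0 ?ltr0n. Qed.

Let T_itv (k : nat) : (0 < k)%N ->
  [/\ (0 < T k)%N,
    Num.sqrt 3 * k%:R * M / L + N%:R * k%:R ^+ 2 * sigma ^+ 2 / (Om2 * L ^+ 2)
      <= (T k)%:R &
    (T k)%:R <= Num.sqrt 3 * k%:R * M / L
      + N%:R * k%:R ^+ 2 * sigma ^+ 2 / (Om2 * L ^+ 2) + 1].
Proof.
by move=> k0; apply: natr_absz_ceil; rewrite ltr_wpDr// smoothness_term.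
Qed.

Lemma smps_T_gt0 (k : nat) : (0 < k)%N -> (0 < T k)%N.
Proof. by case/T_itv. Qed.

Let sqrt3_itv : 3 / 2 <= Num.sqrt (3 : R) <= 2.
Proof.
have s0 : 0 <= Num.sqrt (3 : R) by rewrite sqrtr_ge0.
have s3 : Num.sqrt (3 : R) ^+ 2 = 3 by rewrite sqr_sqrtr.
by rewrite expr2 in s3; apply/andP; split; nra.
Qed.

Lemma smps_T_large (k : nat) : (0 < k)%N -> 3 * M * k%:R <= 2 * L * (T k)%:R.
Proof.
move=> k0; have [_ h _] := T_itv k0; have /andP[s3 _] := sqrt3_itv.
have h1 : Num.sqrt 3 * k%:R * M / L <= (T k)%:R.
  by apply: le_trans h; rewrite lerDl.
rewrite ler_pdivrMr// in h1.
have kM : 0 <= k%:R * M by rewrite mulr_ge0// ltW.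
have := ler_wpM2r kM s3; lra.
Qed.

Lemma smps_T_variance (k : nat) : (0 < k)%N ->
  N%:R * k%:R ^+ 2 * sigma ^+ 2 <= (T k)%:R * (Om2 * L ^+ 2).
Proof.
move=> k0; have [_ h _] := T_itv k0.
rewrite -ler_pdivrMr ?mulr_gt0 ?exprn_gt0//; apply: le_trans h.
by rewrite lerDr ltW// smoothness_term.
Qed.

Lemma smps_grad_evalsE : smps_grad_evals N = N.
Proof. by rewrite /smps_grad_evals sum_nat_const_nat subn1 muln1. Qed.

(** [T_k] is bounded by its value at [k = N]; the last summand pays for the
    rounding in [T_k]. *)
Lemma smps_oper_evals_le : (smps_oper_evals N T)%:R <=
  4 * N%:R ^+ 2 * M / L + 2 * (N%:R ^+ 4 * sigma ^+ 2 / (Om2 * L ^+ 2)) + 2 * N%:R.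
Proof.
rewrite /smps_oper_evals natr_sum.
apply: (@le_trans _ _ (\sum_(1 <= k < N.+1) (4 * N%:R * M / L +
    2 * (N%:R ^+ 3 * sigma ^+ 2 / (Om2 * L ^+ 2)) + 2))); last first.
  rewrite sumr_const_nat subn1 -mulr_natl /= le_eqVlt; apply/orP; left; apply/eqP.
  by field; rewrite !gt_eqF.
apply: ler_sum_nat => k; rewrite ltnS => /andP[k0 kN].
rewrite sum_nat_const_nat subn1 natrM /=.
have [_ _ h] := T_itv k0; have /andP[_ s3] := sqrt3_itv.
have kNR : k%:R <= N%:R :> R by rewrite ler_nat.
have t1 : Num.sqrt 3 * k%:R * M / L <= 2 * N%:R * M / L.
  by rewrite !ler_pM2r ?invr_gt0// ler_pM ?sqrtr_ge0.
have t2 : N%:R * k%:R ^+ 2 * sigma ^+ 2 / (Om2 * L ^+ 2) <=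
    N%:R ^+ 3 * sigma ^+ 2 / (Om2 * L ^+ 2).
  rewrite ler_pM2r ?invr_gt0 ?mulr_gt0 ?exprn_gt0//.
  by rewrite ler_wpM2r ?sqr_ge0// [leRHS]exprS ler_wpM2l// lerXn2r ?nnegrE.
lra.
Qed.

End parameters.

Theorem theorem2p10 (R : realType) :
  exists C : R, 0 < C /\
  forall (n : nat) (Z : set 'rV[R]_n)
    (d : 'rV[R]_n -> R) (gradd : 'rV[R]_n -> 'rV[R]_n)
    (H : 'rV[R]_n -> 'rV[R]_n)
    (G : 'rV[R]_n -> R) (gradG : 'rV[R]_n -> 'rV[R]_n)
    (z0 : 'rV[R]_n) (M delta L sigma eps : R),
  closed Z -> convex_set Z -> Z z0 ->
  prox_function Z d gradd ->
  0 < M -> 0 < delta -> 0 < L ->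
  monotone_on Z H -> delta_smooth_on M delta Z H ->
  convex_smooth_on L Z G gradG ->
  has_ubound [set bregman d gradd z0 z | z in Z] ->
  let Om2 := Omega2 Z d gradd z0 in
  0 < eps -> 1 <= L * Om2 / eps ->
  exists N : nat,
  let T := smps_T L M sigma Om2 N in
  [/\ (1 <= N)%N,
      (smps_grad_evals N)%:R <= C * Num.sqrt (L * Om2 / eps),
      (smps_oper_evals N T)%:R <=
        C * (M * Om2 / eps + sigma ^+ 2 * Om2 / eps ^+ 2
             + Num.sqrt (L * Om2 / eps)) &
      forall (dO dS : measure_display) (Omega : measurableType dO)
        (Xi : measurableType dS) (P : probability Omega R)
        (calH : 'rV[R]_n -> Xi -> 'rV[R]_n)
        (zeta : nat -> nat -> {RV P >-> Xi})
        (it : Omega -> smps_iterates R n),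
      jointly_measurable Z calH ->
      independent_on P (sample_indices N T)
        (fun ks : nat * nat => zeta ks.1 ks.2 : Omega -> Xi) ->
      (forall w, smps_run Z d gradd gradG calH z0 N T
         (smps_beta L) (smps_gamma R) (smps_eta L T)
         (fun k s => zeta k s w) (it w)) ->
      stochastic_oracle sigma calH H N T zeta it ->
      (\int[P]_w ereal_sup [set (Qgap G H (z_bar (it w) N) z)%:E | z in Z]
         <= (eps + delta)%:E)%E].
Proof.
(* The largest constant is that of the variance term: [N <= 6 sqrt r] gives
   [N ^ 4 <= 1296 r ^ 2], doubled because an inner step calls the oracle twice. *)
exists 2592; split; first by rewrite ltr0n.
move=> n Z d gradd H G gradG z0 M delta L sigma eps.
move=> clZ cZ Z0 dprox M0 _ L0 Hmono Hsm Gsm Vbd Om2 eps0 r1.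
set r := L * Om2 / eps in r1 *; set s := Num.sqrt r.
have r0 : 0 < r := lt_le_trans ltr01 r1.
have LOm : L * Om2 = r * eps by rewrite /r divfK// gt_eqF.
have Om0 : 0 < Om2 by rewrite -(pmulr_rgt0 _ L0) LOm mulr_gt0.
have s1 : 1 <= s by rewrite -[1]sqrtr1 ler_wsqrtr.
have s0 : 0 < s := lt_le_trans ltr01 s1.
have s2 : s ^+ 2 = r by rewrite sqr_sqrtr// ltW.
(* [5 ^ 2] exceeds the factor 21 of [expected_gap_le]. *)
pose N := `|Num.ceil (5 * s)|%N.
have [|N_gt0 Nge Nle] := @natr_absz_ceil R (5 * s); first by rewrite mulr_gt0.
rewrite -/N in N_gt0 Nge Nle.
have Nge0 : 0 <= N%:R :> R by [].
have N6 : N%:R <= 6 * s by lra.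
have N2 : N%:R ^+ 2 <= 36 * r by rewrite -s2 expr2; nra.
have N2' : 25 * r <= N%:R ^+ 2 by rewrite -s2 !expr2; nra.
have V_le z : Z z -> bregman d gradd z0 z <= Om2.
  by move=> Zz; apply: ub_le_sup => //; exists z.
exists N; split => //.
- by rewrite smps_grad_evalsE; lra.
- apply: le_trans (smps_oper_evals_le sigma N M0 L0 Om0) _.
  have t1 : N%:R ^+ 2 * M / L <= 36 * (M * Om2 / eps).
    rewrite -mulrA; apply: le_trans (ler_wpM2r _ N2) _.
      by rewrite divr_ge0// ltW.
    by rewrite /r le_eqVlt; apply/orP; left; apply/eqP; field; rewrite !gt_eqF.
  have t2 : N%:R ^+ 4 * sigma ^+ 2 / (Om2 * L ^+ 2) <=
      1296 * (sigma ^+ 2 * Om2 / eps ^+ 2).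
    have N4 : N%:R ^+ 4 <= (36 * r) ^+ 2.
      have h0 := le_trans (sqr_ge0 _) N2.
      by rewrite (exprM _ 2 2) lerXn2r// nnegrE sqr_ge0.
    rewrite -mulrA; apply: le_trans (ler_wpM2r _ N4) _.
      by rewrite divr_ge0 ?sqr_ge0// mulr_ge0 ?sqr_ge0// ltW.
    by rewrite /r le_eqVlt; apply/orP; left; apply/eqP; field; rewrite !gt_eqF.
  have p1 : 0 <= M * Om2 / eps by rewrite divr_ge0 ?mulr_ge0 ?ltW.
  have p2 : 0 <= sigma ^+ 2 * Om2 / eps ^+ 2.
    by rewrite divr_ge0 ?sqr_ge0// mulr_ge0 ?sqr_ge0// ltW.
  rewrite -!mulrA in t1 t2 p1 p2 *; lra.
move=> dO dS Omega Xi P calH zeta it mcalH indep run oracle.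
set T := smps_T L M sigma Om2 N in indep run oracle.
apply: (le_trans (@expected_gap_le _ _ _ _ _ _ P Z d gradd H G gradG z0 M delta
  sigma L Om2 N T calH (fun ks => zeta ks.1 ks.2) it clZ cZ Z0 _ dprox Gsm L0
  mcalH Hmono Hsm V_le N_gt0 _ _ run indep oracle)).
- by move=> k /andP[k0 _]; exact: smps_T_gt0.
- by move=> k /andP[k0 _]; exact: smps_T_large.
- by move=> k /andP[k0 _]; exact: smps_T_variance.
rewrite lee_fin lerD2r ler_pdivrMr ?mulr_gt0 ?ltr0n//.
rewrite -[N.+1%:R]natr1 -mulrA LOm.
have := ler_wpM2l (ltW eps0) N2'; have := mulr_ge0 (ltW eps0) Nge0.
have := mulr_gt0 r0 eps0; rewrite expr2; lra.
Qed.
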